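(* Let $\mathcal C$ be a triangulated category with a weight structure $w$, let $t:\mathcal C\to K_{\mathfrak w}(\underline{Hw})$ be the weight complex functor, let $g:M\to M'$ be a $\mathcal C$-morphism and $n\in\mathbb Z$. Then the following statements are valid. I.1. $t(g)$ is an isomorphism if and only if $\operatorname{Cone}(g)$ is a $w$-degenerate object. I.2. Any extension of a left $w$-degenerate object of $\mathcal C$ by a right $w$-degenerate one is $w$-degenerate. I.3. If $M$ is an extension of a left $w$-degenerate object by an element of $\mathcal C_{w\le n}$ (resp. is an extension of an element of $\mathcal C_{w\ge n}$ by a right $w$-degenerate object) then $t(M)\in K(\underline{Hw})_{w^{st}\le n}$ (resp. $t(M)\in K(\underline{Hw})_{w^{st}\ge n}$). II. Assume that $(\mathcal C,w)$ is weight-Karoubian. II.1. $M$ is $w$-degenerate if and only if $M$ is an extension of a left $w$-degenerate object by a right $w$-degenerate one. II.2. $t(M)\in K(\underline{Hw})_{w^{st}\le n}$ (resp. $t(M)\in K(\underline{Hw})_{w^{st}\ge n}$) if and only if $M$ is an extension of a left $w$-degenerate object by an element of $\mathcal C_{w\le n}$ (resp. is an extension of an element of $\mathcal C_{w\ge n}$ by a right $w$-degenerate object).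
   Context: Weight structures. A weight structure $w$ on a triangulated category $\mathcal C$ is a pair of classes $\mathcal C_{w\le 0},\mathcal C_{w\ge 0}\subset\operatorname{Obj}\mathcal C$ such that: (i) both are closed under retracts; (ii) $\mathcal C_{w\le 0}\subset\mathcal C_{w\le 0}[1]$ and $\mathcal C_{w\ge 0}[1]\subset\mathcal C_{w\ge 0}$; (iii) $\mathcal C(X,Y)=0$ for $X\in\mathcal C_{w\le 0}$, $Y\in\mathcal C_{w\ge 0}[1]$; (iv) every object $M$ fits into a distinguished triangle $LM\to M\to RM\to LM[1]$ with $LM\in\mathcal C_{w\le 0}$, $RM\in\mathcal C_{w\ge 0}[1]$. Put $\mathcal C_{w\ge i}=\mathcal C_{w\ge 0}[i]$, $\mathcal C_{w\le i}=\mathcal C_{w\le 0}[i]$, $\mathcal C_{w=i}=\mathcal C_{w\ge i}\cap\mathcal C_{w\le i}$. The heart $\underline{Hw}$ is the full subcategory of $\mathcal C$ with object class $\mathcal C_{w=0}$. $(\mathcal C,w)$ is weight-Karoubian if all idempotents in $\underline{Hw}$ split. An $m$-weight decomposition of $M$ is a (non-canonical) distinguished triangle $w_{\le m}M\to M\to w_{\ge m+1}M\to (w_{\le m}M)[1]$ with $w_{\le m}M\in\mathcal C_{w\le m}$ and $w_{\ge m+1}M\in\mathcal C_{w\ge m+1}$. An object $C$ is an extension of $B$ by $A$ if there is a distinguished triangle $A\to C\to B\to A[1]$. $M$ is left (resp. right) $w$-degenerate if $M\in\bigcap_{i\in\mathbb Z}\mathcal C_{w\ge i}$ (resp. $M\in\bigcap_{i\in\mathbb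 Z}\mathcal C_{w\le i}$). $M$ is $w$-degenerate if $t(M)$ is zero (in $K_{\mathfrak w}(\underline{Hw})$, equivalently in $K(\underline{Hw})$). Complexes. For an additive category $\mathcal B$, $K(\mathcal B)$ is the homotopy category of (unbounded) cohomological complexes over $\mathcal B$. $K(\mathcal B)_{w^{st}\le n}$ (resp. $K(\mathcal B)_{w^{st}\ge n}$) is the class of complexes homotopy equivalent to complexes concentrated in degrees $\ge -n$ (resp. $\le -n$). Chain maps $m_1,m_2:A\to B$ are weakly homotopic if $m_1-m_2=d_Bx+yd_A$ for some collections $x^*,y^*$ of morphisms $A^*\to B^{*-1}$. $K_{\mathfrak w}(\mathcal B)$ is the quotient of $K(\mathcal B)$ by weak homotopy; the projection $K(\mathcal B)\to K_{\mathfrak w}(\mathcal B)$ is full and conservative. Weight complexes. For each $M$ fix weight decompositions with first arrows $c_n:w_{\le n}M\to M$, $n\in\mathbb Z$. There is a unique $g_n:w_{\le n}M\to w_{\le n+1}M$ with $c_{n+1}g_n=c_n$. Fix distinguished triangles $w_{\le n-1}M\xrightarrow{g_{n-1}}w_{\le n}M\to M^{-n}[n]\to(w_{\le n-1}M)[1]$; then $M^{-n}\in\mathcal C_{w=0}$, and the compositions $M^{-n}[n]\to(w_{\le n-1}M)[1]\to M^{1-n}[n]$, shifted by $[-n]$, are the differentials of the complex $t(M)=(M^i)$. For $f:M\to M'$ choose $f_{\le n}:w_{\le n}M\to w_{\le n}M'$ compatible with $f$ (these are automatically compatible with the $g_n$) and complete them to morphisms of the triangles above; the third components, shifted by $[-n]$,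 form a chain map $t(M)\to t(M')$ whose class in $K_{\mathfrak w}(\underline{Hw})$ does not depend on the choices made for $f$. This gives an additive functor $t:\mathcal C\to K_{\mathfrak w}(\underline{Hw})$, well-defined up to isomorphism. *)

(* Defs.v *)
From HB Require Import structures.
From mathcomp Require Import all_boot all_order all_algebra.
From mathcomp Require Import generic_quotient ring_quotient.
From mathcomp Require Import boolp.
From mathcomp Require Import zify.

Set Implicit Arguments.
Unset Strict Implicit.
Unset Printing Implicit Defensive.

Import GRing.Theory.
Local Open Scope ring_scope.
Local Open Scope quotient_scope.

Declare Scope cat_scope.
Delimit Scope cat_scope with cat.
Local Open Scope cat_scope.

#[local] Obligation Tactic := idtac.

(* The choice structure carried by a [zmodType] is no restriction on the groups
   of morphisms, since [boolp] provides it for every type. *)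
Record preadditive := Preadditive {
  Ob :> Type;
  mor : Ob -> Ob -> zmodType;
  idm : forall X, mor X X;
  mcomp : forall X Y Z, mor Y Z -> mor X Y -> mor X Z;
  compA : forall X Y Z W (h : mor Z W) (g : mor Y Z) (f : mor X Y),
    mcomp h (mcomp g f) = mcomp (mcomp h g) f;
  comp1m : forall X Y (f : mor X Y), mcomp (idm Y) f = f;
  compm1 : forall X Y (f : mor X Y), mcomp f (idm X) = f;
  compDl : forall X Y Z (g g' : mor Y Z) (f : mor X Y),
    mcomp (g + g') f = mcomp g f + mcomp g' f;
  compDr : forall X Y Z (g : mor Y Z) (f f' : mor X Y),
    mcomp g (f + f') = mcomp g f + mcomp g f' }.

Arguments mor {p} X Y.
Arguments idm {p} X.
Arguments mcomp {p X Y Z} g f.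
Notation "g \oc f" := (mcomp g f) (at level 40, left associativity) : cat_scope.

Section PreadditiveTheory.
Variable C : preadditive.
Implicit Types X Y Z : C.

Lemma comp0m X Y Z (f : mor X Y) : (0 : mor Y Z) \oc f = 0.
Proof. by apply: (@addrI _ (0 \oc f)); rewrite -compDl !addr0. Qed.

Lemma compm0 X Y Z (g : mor Y Z) : g \oc (0 : mor X Y) = 0.
Proof. by apply: (@addrI _ (g \oc 0)); rewrite -compDr !addr0. Qed.

Lemma compNm X Y Z (g : mor Y Z) (f : mor X Y) : (- g) \oc f = - (g \oc f).
Proof. by apply: (@addrI _ (g \oc f)); rewrite -compDl !subrr comp0m. Qed.

Lemma compmN X Y Z (g : mor Y Z) (f : mor X Y) : g \oc (- f) = - (g \oc f).
Proof. by apply: (@addrI _ (g \oc f)); rewrite -compDr !subrr compm0. Qed.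

Definition is_iso X Y (f : mor X Y) : Prop :=
  exists g : mor Y X, g \oc f = idm X /\ f \oc g = idm Y.

Definition isomorphic X Y : Prop := exists f : mor X Y, is_iso f.

Definition is_zero X : Prop :=
  forall Y, (forall f : mor X Y, f = 0) /\ (forall f : mor Y X, f = 0).

Definition retract_of X Y : Prop :=
  exists (s : mor X Y) (r : mor Y X), r \oc s = idm X.

Definition is_biproduct X Y Z : Prop :=
  exists (i1 : mor X Z) (i2 : mor Y Z) (p1 : mor Z X) (p2 : mor Z Y),
    [/\ p1 \oc i1 = idm X, p2 \oc i2 = idm Y,
        p1 \oc i2 = 0, p2 \oc i1 = 0
      & i1 \oc p1 + i2 \oc p2 = idm Z].

Definition idempotents_split : Prop :=
  forall X (e : mor X X), e \oc e = e ->
    exists (Y : C) (s : mor Y X) (r : mor X Y), r \oc s = idm Y /\ s \oc r = e.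

End PreadditiveTheory.

Definition additive_cat (C : preadditive) : Prop :=
  (exists Z : C, is_zero Z) /\
  (forall X Y : C, exists Z : C, is_biproduct X Y Z).

Record functor (C D : preadditive) := Functor {
  fob :> C -> D;
  fmap : forall X Y : C, mor X Y -> mor (fob X) (fob Y);
  fmap1 : forall X, fmap (idm X) = idm (fob X);
  fmapM : forall X Y Z (g : mor Y Z) (f : mor X Y),
    fmap (g \oc f) = fmap g \oc fmap f;
  fmapD : forall X Y (f g : mor X Y), fmap (f + g) = fmap f + fmap g }.

Arguments fmap {C D} F {X Y} f : rename.

Definition id_functor (C : preadditive) : functor C C :=
  @Functor C C (fun X => X) (fun _ _ f => f)
    (fun _ => erefl) (fun _ _ _ _ _ => erefl) (fun _ _ _ _ => erefl).

Program Definition comp_functor (C D E : preadditive) (G : functor D E)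
    (F : functor C D) : functor C E :=
  @Functor C E (fun X => G (F X)) (fun _ _ f => fmap G (fmap F f)) _ _ _.
Next Obligation. by move=> C D E G F X; rewrite /= !fmap1. Qed.
Next Obligation. by move=> C D E G F X Y Z g f; rewrite /= !fmapM. Qed.
Next Obligation. by move=> C D E G F X Y f g; rewrite /= !fmapD. Qed.

Fixpoint iter_functor (C : preadditive) (F : functor C C) (n : nat) :
    functor C C :=
  if n is n'.+1 then comp_functor F (iter_functor F n') else id_functor C.

Definition full_subcategory (C : preadditive) (P : C -> Prop) : preadditive :=
  @Preadditive {X : C | P X} (fun X Y => mor (sval X) (sval Y))
    (fun X => idm (sval X)) (fun _ _ _ g f => g \oc f)
    (fun _ _ _ _ => @compA C _ _ _ _) (fun _ _ => @comp1m C _ _)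
    (fun _ _ => @compm1 C _ _) (fun _ _ _ => @compDl C _ _ _)
    (fun _ _ _ => @compDr C _ _ _).

Record cat_ideal (C : preadditive) := CatIdeal {
  imem : forall X Y : C, mor X Y -> Prop;
  imem0 : forall X Y, imem (0 : mor X Y);
  imemB : forall X Y (f g : mor X Y), imem f -> imem g -> imem (f - g);
  imem_compl : forall X Y Z (g : mor Y Z) (f : mor X Y),
    imem f -> imem (g \oc f);
  imem_compr : forall X Y Z (g : mor Y Z) (f : mor X Y),
    imem g -> imem (g \oc f) }.

Arguments imem {C} I {X Y} f : rename.

Section QuotientCategory.
Variables (C : preadditive) (I : cat_ideal C).
Implicit Types X Y Z : C.

Definition ideal_pred X Y : {pred mor X Y} := fun f => `[< imem I f >].

Lemma ideal_pred_closed X Y : zmod_closed (@ideal_pred X Y).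
Proof.
split; first exact/asboolP/imem0.
by move=> f g /asboolP fI /asboolP gI; apply/asboolP/imemB.
Qed.

HB.instance Definition _ X Y :=
  GRing.isZmodClosed.Build (mor X Y) (@ideal_pred X Y) (@ideal_pred_closed X Y).

Definition qhom X Y : zmodType := Quotient.quot (@ideal_pred X Y).

Definition cls X Y (f : mor X Y) : qhom X Y := \pi_(qhom X Y) f.

Lemma cls_eq X Y (f g : mor X Y) : cls f = cls g <-> imem I (f - g).
Proof.
rewrite /cls; split=> [/eqP | fgI]; last apply/eqP.
  by rewrite -Quotient.idealrBE => /asboolP.
by rewrite -Quotient.idealrBE; apply/asboolP.
Qed.

Lemma cls_surj X Y (q : qhom X Y) : exists f : mor X Y, cls f = q.
Proof. by exists (repr q); rewrite /cls reprK. Qed.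

Lemma clsD X Y (f g : mor X Y) : cls (f + g) = cls f + cls g.
Proof. by rewrite /cls raddfD. Qed.

Definition qcomp X Y Z (g : qhom Y Z) (f : qhom X Y) : qhom X Z :=
  cls (repr g \oc repr f).

Lemma qcomp_cls X Y Z (g : mor Y Z) (f : mor X Y) :
  qcomp (cls g) (cls f) = cls (g \oc f).
Proof.
have reprI A B (h : mor A B) : imem I (repr (cls h) - h).
  by apply/cls_eq; rewrite /cls reprK.
apply/cls_eq.
set g' := repr (cls g); set f' := repr (cls f).
have -> : g' \oc f' - g \oc f = (g' - g) \oc f' - g \oc (f - f').
  by rewrite compDl compDr compNm compmN opprD opprK addrA addrAC addrNK.
apply: imemB; first exact/imem_compr/reprI.
by apply: imem_compl; rewrite -opprB -sub0r; apply: imemB;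
  [apply: imem0 | apply: reprI].
Qed.

Program Definition quotient_category : preadditive :=
  @Preadditive C qhom (fun X => cls (idm X)) qcomp _ _ _ _ _.
Next Obligation.
move=> X Y Z W h g f; have [h' <-] := cls_surj h; have [g' <-] := cls_surj g.
by have [f' <-] := cls_surj f; rewrite !qcomp_cls compA.
Qed.
Next Obligation.
by move=> X Y f; have [f' <-] := cls_surj f; rewrite qcomp_cls comp1m.
Qed.
Next Obligation.
by move=> X Y f; have [f' <-] := cls_surj f; rewrite qcomp_cls compm1.
Qed.
Next Obligation.
move=> X Y Z g g' f; have [h <-] := cls_surj g; have [h' <-] := cls_surj g'.
have [k <-] := cls_surj f.
by rewrite -clsD !qcomp_cls compDl clsD.
Qed.
Next Obligation.
move=> X Y Z g f f'; have [h <-] := cls_surj f; have [h' <-] := cls_surj f'.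
have [k <-] := cls_surj g.
by rewrite -clsD !qcomp_cls compDr clsD.
Qed.

End QuotientCategory.

Record complex (B : preadditive) := Complex {
  cob :> int -> B;
  cdiff : forall i, mor (cob i) (cob (i + 1));
  cdiffK : forall i, cdiff (i + 1) \oc cdiff i = 0 }.

Record chain_map (B : preadditive) (X Y : complex B) := ChainMap {
  cmap :> forall i, mor (X i) (Y i);
  cmapP : forall i, cmap (i + 1) \oc cdiff X i = cdiff Y i \oc cmap i }.

Section Complexes.
Variable B : preadditive.
Implicit Types X Y Z : complex B.

Lemma chain_map_eq X Y (f g : chain_map X Y) : (forall i, f i = g i) -> f = g.
Proof.
case: f g => [f fP] [g gP] /= fg.
have E : f = g by apply: functional_extensionality_dep.
by rewrite E in fP *; congr ChainMap; apply: Prop_irrelevance.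
Qed.

Program Definition cm0 X Y : chain_map X Y := @ChainMap B X Y (fun=> 0) _.
Next Obligation. by move=> X Y i /=; rewrite comp0m compm0. Qed.

Program Definition cmN X Y (f : chain_map X Y) : chain_map X Y :=
  @ChainMap B X Y (fun i : int => - f i) _.
Next Obligation. by move=> X Y f i /=; rewrite compNm compmN cmapP. Qed.

Program Definition cmD X Y (f g : chain_map X Y) : chain_map X Y :=
  @ChainMap B X Y (fun i : int => f i + g i) _.
Next Obligation. by move=> X Y f g i /=; rewrite compDl compDr !cmapP. Qed.

Program Definition cm1 X : chain_map X X :=
  @ChainMap B X X (fun i : int => idm (X i)) _.
Next Obligation. by move=> X i /=; rewrite comp1m compm1. Qed.

Program Definition cmM X Y Z (g : chain_map Y Z) (f : chain_map X Y) :
  chain_map X Z := @ChainMap B X Z (fun i : int => g i \oc f i) _.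
Next Obligation.
by move=> X Y Z g f i /=; rewrite -compA cmapP [LHS]compA cmapP -compA.
Qed.

HB.instance Definition _ X Y := gen_eqMixin (chain_map X Y).
HB.instance Definition _ X Y := gen_choiceMixin (chain_map X Y).

Fact cmDA X Y : associative (@cmD X Y).
Proof. by move=> f g h; apply: chain_map_eq => i /=; rewrite addrA. Qed.
Fact cmDC X Y : commutative (@cmD X Y).
Proof. by move=> f g; apply: chain_map_eq => i /=; rewrite addrC. Qed.
Fact cmD0 X Y : left_id (cm0 X Y) (@cmD X Y).
Proof. by move=> f; apply: chain_map_eq => i /=; rewrite add0r. Qed.
Fact cmDN X Y : left_inverse (cm0 X Y) (@cmN X Y) (@cmD X Y).
Proof. by move=> f; apply: chain_map_eq => i /=; rewrite addNr. Qed.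

HB.instance Definition _ X Y := GRing.isZmodule.Build (chain_map X Y)
  (@cmDA X Y) (@cmDC X Y) (@cmD0 X Y) (@cmDN X Y).

Program Definition Ch : preadditive :=
  @Preadditive (complex B) (fun X Y => chain_map X Y) cm1 cmM _ _ _ _ _.
Next Obligation.
by move=> X Y Z W h g f; apply: chain_map_eq => i /=; rewrite compA.
Qed.
Next Obligation. by move=> X Y f; apply: chain_map_eq => i /=; rewrite comp1m. Qed.
Next Obligation. by move=> X Y f; apply: chain_map_eq => i /=; rewrite compm1. Qed.
Next Obligation.
by move=> X Y Z g g' f; apply: chain_map_eq => i /=; rewrite compDl.
Qed.
Next Obligation.
by move=> X Y Z g f f'; apply: chain_map_eq => i /=; rewrite compDr.
Qed.

(* [x i] has source X^{i+1} and target Y^i, i.e., it is the component of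
   index i+1 of a collection X^* -> Y^{*-1}.  Both conditions are written in
   degrees i+1, which exhaust the integers. *)
Definition weakly_null X Y (m : chain_map X Y) : Prop :=
  exists x y : forall i, mor (X (i + 1)) (Y i),
    forall i, m (i + 1) = cdiff Y i \oc x i + y (i + 1) \oc cdiff X (i + 1).

Definition null_homotopic X Y (m : chain_map X Y) : Prop :=
  exists x : forall i, mor (X (i + 1)) (Y i),
    forall i, m (i + 1) = cdiff Y i \oc x i + x (i + 1) \oc cdiff X (i + 1).

Program Definition weakly_null_ideal : cat_ideal Ch :=
  @CatIdeal Ch weakly_null _ _ _ _.
Next Obligation.
move=> X Y; exists (fun=> 0), (fun=> 0) => i /=.
by rewrite compm0 comp0m addr0.
Qed.
Next Obligation.
move=> X Y f g [x [y xyf]] [x' [y' xyg]].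
exists (fun i => x i - x' i), (fun i => y i - y' i) => i /=.
by rewrite xyf xyg compDl compDr compNm compmN opprD addrACA.
Qed.
Next Obligation.
move=> X Y Z g f [x [y xyf]].
exists (fun i => g i \oc x i), (fun i => g i \oc y i) => i /=.
by rewrite xyf compDr !compA cmapP.
Qed.
Next Obligation.
move=> X Y Z g f [x [y xyg]].
exists (fun i => x i \oc f (i + 1)), (fun i => y i \oc f (i + 1)) => i /=.
by rewrite xyg compDl -!compA cmapP.
Qed.

Program Definition null_homotopic_ideal : cat_ideal Ch :=
  @CatIdeal Ch null_homotopic _ _ _ _.
Next Obligation.
by move=> X Y; exists (fun=> 0) => i /=; rewrite compm0 comp0m addr0.
Qed.
Next Obligation.
move=> X Y f g [x xf] [x' xg].
exists (fun i => x i - x' i) => i /=.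
by rewrite xf xg compDl compDr compNm compmN opprD addrACA.
Qed.
Next Obligation.
move=> X Y Z g f [x xf].
exists (fun i => g i \oc x i) => i /=.
by rewrite xf compDr !compA cmapP.
Qed.
Next Obligation.
move=> X Y Z g f [x xg].
exists (fun i => x i \oc f (i + 1)) => i /=.
by rewrite xg compDl -!compA cmapP.
Qed.

Definition Khtpy : preadditive := quotient_category null_homotopic_ideal.

(* Homotopic chain maps are weakly homotopic, so the quotient of [Khtpy] by
   weak homotopy is the quotient of [Ch] by it. *)
Definition Kweak : preadditive := quotient_category weakly_null_ideal.

Definition Kst_le (n : int) (X : complex B) : Prop :=
  exists Y : complex B,
    (forall i, (i < - n)%R -> is_zero (Y i)) /\ @isomorphic Khtpy X Y.

Definition Kst_ge (n : int) (X : complex B) : Prop :=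
  exists Y : complex B,
    (forall i, (- n < i)%R -> is_zero (Y i)) /\ @isomorphic Khtpy X Y.

End Complexes.

(* The translation is an autoequivalence [sh] with quasi-inverse [ush]; a
   strict automorphism is the special case of identity (co)unit. *)
Record triangulated := Triangulated {
  tcat :> preadditive;
  tcat_additive : additive_cat tcat;
  sh : functor tcat tcat;
  ush : functor tcat tcat;
  sh_counit : forall X, mor (sh (ush X)) X;
  sh_counit_iso : forall X, is_iso (sh_counit X);
  sh_counit_nat : forall X Y (f : mor X Y),
    f \oc sh_counit X = sh_counit Y \oc fmap sh (fmap ush f);
  sh_unit : forall X, mor X (ush (sh X));
  sh_unit_iso : forall X, is_iso (sh_unit X);
  sh_unit_nat : forall X Y (f : mor X Y),
    sh_unit Y \oc f = fmap ush (fmap sh f) \oc sh_unit X;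
  dist : forall X Y Z, mor X Y -> mor Y Z -> mor Z (sh X) -> Prop;
  dist_iso : forall X Y Z X' Y' Z'
      (f : mor X Y) (g : mor Y Z) (h : mor Z (sh X))
      (f' : mor X' Y') (g' : mor Y' Z') (h' : mor Z' (sh X'))
      (a : mor X X') (b : mor Y Y') (c : mor Z Z'),
    is_iso a -> is_iso b -> is_iso c ->
    b \oc f = f' \oc a -> c \oc g = g' \oc b -> fmap sh a \oc h = h' \oc c ->
    dist f g h -> dist f' g' h';
  dist_id : forall X Z, is_zero Z ->
    dist (idm X) (0 : mor X Z) (0 : mor Z (sh X));
  dist_cone : forall X Y (f : mor X Y),
    exists Z (g : mor Y Z) (h : mor Z (sh X)), dist f g h;
  dist_rot : forall X Y Z (f : mor X Y) (g : mor Y Z) (h : mor Z (sh X)),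
    dist f g h <-> dist g h (- fmap sh f);
  dist_complete : forall X Y Z X' Y' Z'
      (f : mor X Y) (g : mor Y Z) (h : mor Z (sh X))
      (f' : mor X' Y') (g' : mor Y' Z') (h' : mor Z' (sh X'))
      (a : mor X X') (b : mor Y Y'),
    dist f g h -> dist f' g' h' -> b \oc f = f' \oc a ->
    exists c : mor Z Z', c \oc g = g' \oc b /\ fmap sh a \oc h = h' \oc c;
  dist_octahedral : forall X Y Z Z' X' Y' (f : mor X Y) (g : mor Y Z)
      (f1 : mor Y Z') (f2 : mor Z' (sh X))
      (g1 : mor Z X') (g2 : mor X' (sh Y))
      (h1 : mor Z Y') (h2 : mor Y' (sh X)),
    dist f f1 f2 -> dist g g1 g2 -> dist (g \oc f) h1 h2 ->
    exists (u : mor Z' Y') (v : mor Y' X'),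
      [/\ dist u v (fmap sh f1 \oc g2),
          u \oc f1 = h1 \oc g, h2 \oc u = f2,
          v \oc h1 = g1 & g2 \oc v = fmap sh f \oc h2] }.

Arguments sh {t}.
Arguments ush {t}.
Arguments sh_counit {t} X.
Arguments sh_unit {t} X.
Arguments dist {t X Y Z} f g h.

Section Triangulated.
Variable C : triangulated.
Implicit Types X Y Z : C.

(* X[n] *)
Definition tshift (n : int) : functor C C :=
  match n with
  | Posz k => iter_functor sh k
  | Negz k => iter_functor ush k.+1
  end.

(* [shift_iso] is the isomorphism X[k][1] -> X[m] for k + 1 = m: the identity for
   k >= 0 and the counit for k < 0.  [succz] is the computing form of k + 1. *)
Definition succz (k : int) : int :=
  match k with
  | Posz j => Posz j.+1
  | Negz 0 => Posz 0
  | Negz j.+1 => Negz j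
  end.

Lemma succzE k : succz k = k + 1.
Proof. by case: k => [k|[|k]] //=; lia. Qed.

Definition shift_succ (k : int) X : mor (sh (tshift k X)) (tshift (succz k) X) :=
  match k return mor (sh (tshift k X)) (tshift (succz k) X) with
  | Posz j => idm (iter_functor sh j.+1 X)
  | Negz 0 => sh_counit X
  | Negz j.+1 => sh_counit (iter_functor ush j.+1 X)
  end.

Definition shift_iso (k m : int) (e : k + 1 = m) X :
    mor (sh (tshift k X)) (tshift m X) :=
  eq_rect (succz k) (fun m' => mor (sh (tshift k X)) (tshift m' X))
    (shift_succ k X) m (etrans (succzE k) e).

Definition is_cone X Y (g : mor X Y) Z : Prop :=
  exists (a : mor Y Z) (b : mor Z (sh X)), dist g a b.

(* Z is an extension of Y by X. *)
Definition extension_of Z Y X : Prop :=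
  exists (a : mor X Z) (b : mor Z Y) (c : mor Y (sh X)), dist a b c.

(* The class P[n], closed under isomorphism as [sh] is only an equivalence. *)
Definition shift_class (P : C -> Prop) (n : int) : C -> Prop :=
  fun X => exists Y, P Y /\ isomorphic X (tshift n Y).

Definition closed_retracts (P : C -> Prop) : Prop :=
  forall X Y, retract_of X Y -> P Y -> P X.

Definition triangle_morphism X Y Z X' Y' Z'
    (f : mor X Y) (g : mor Y Z) (h : mor Z (sh X))
    (f' : mor X' Y') (g' : mor Y' Z') (h' : mor Z' (sh X'))
    (a : mor X X') (b : mor Y Y') (c : mor Z Z') : Prop :=
  [/\ b \oc f = f' \oc a, c \oc g = g' \oc b & fmap sh a \oc h = h' \oc c].

End Triangulated.

Lemma shift_degree (i : int) : - (i + 1) + 1 = - i.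
Proof. lia. Qed.

Record weight_structure (C : triangulated) := WeightStructure {
  wle0 : C -> Prop;
  wge0 : C -> Prop;
  wle0_retract : closed_retracts wle0;
  wge0_retract : closed_retracts wge0;
  wle0_shift : forall X, wle0 X -> shift_class wle0 1 X;
  wge0_shift : forall X, shift_class wge0 1 X -> wge0 X;
  w_orth : forall X Y, wle0 X -> shift_class wge0 1 Y ->
    forall f : mor X Y, f = 0;
  w_decomp : forall M, exists (L R : C)
      (a : mor L M) (b : mor M R) (c : mor R (sh L)),
    [/\ wle0 L, shift_class wge0 1 R & dist a b c] }.

Section WeightStructure.
Variables (C : triangulated) (w : weight_structure C).
Implicit Types M X : C.

Definition wle (n : int) : C -> Prop := shift_class (wle0 w) n.
Definition wge (n : int) : C -> Prop := shift_class (wge0 w) n.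
Definition w_eq0 : C -> Prop := fun X => wge 0 X /\ wle 0 X.

Definition Hw : preadditive := full_subcategory w_eq0.

Definition heart_ob (A : Hw) : C := sval A.
Definition heart_hom (A A' : Hw) (f : mor A A') :
  mor (heart_ob A) (heart_ob A') := f.

Definition weight_karoubian : Prop := idempotents_split Hw.

Definition left_degenerate M : Prop := forall i, wge i M.
Definition right_degenerate M : Prop := forall i, wle i M.

Definition weight_decomposition (m : int) (L M : C) (c : mor L M) : Prop :=
  exists (R : C) (b : mor M R) (e : mor R (sh L)),
    [/\ wle m L, wge (m + 1) R & dist c b e].

(* The choices made for an object M. The triangle in degree i is the one with
   third vertex M^i[-i]:
     w_{<= -(i+1)} M -> w_{<= -i} M -> M^i[-i] -> (w_{<= -(i+1)} M)[1],
   so that [wc_g i] is the arrow g_{-(i+1)}. The last field says that d^i,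
   shifted by [-i], is the composition
     M^i[-i] -> (w_{<= -(i+1)} M)[1] -> M^{i+1}[-(i+1)][1] = M^{i+1}[-i];
   this determines d^i as shifts are fully faithful. *)
Record weight_complex_data M := WeightComplexData {
  wc_le : int -> C;
  wc_c : forall n, mor (wc_le n) M;
  wc_cP : forall n, weight_decomposition n (wc_c n);
  wc_complex : complex Hw;
  wc_g : forall i, mor (wc_le (- (i + 1))) (wc_le (- i));
  wc_gP : forall i, wc_c (- i) \oc wc_g i = wc_c (- (i + 1));
  wc_p : forall i, mor (wc_le (- i)) (tshift C (- i) (heart_ob (wc_complex i)));
  wc_q : forall i, mor (tshift C (- i) (heart_ob (wc_complex i)))
                       (sh (wc_le (- (i + 1))));
  wc_dist : forall i, dist (wc_g i) (wc_p i) (wc_q i);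
  wc_diff : forall i,
    fmap (tshift C (- i)) (heart_hom (cdiff wc_complex i))
    = shift_iso (shift_degree i) (heart_ob (wc_complex (i + 1)))
        \oc (fmap sh (wc_p (i + 1)) \oc wc_q i) }.

Arguments wc_le {M} D n : rename.
Arguments wc_c {M} D n : rename.
Arguments wc_g {M} D i : rename.
Arguments wc_p {M} D i : rename.
Arguments wc_q {M} D i : rename.

(* [m] is obtained from f by some choice of the f_{<= n} and of their
   completions to morphisms of triangles. *)
Definition weight_complex_map M M' (D : weight_complex_data M)
    (D' : weight_complex_data M') (f : mor M M')
    (m : chain_map (wc_complex D) (wc_complex D')) : Prop :=
  exists fle : forall n, mor (wc_le D n) (wc_le D' n),
    (forall n, wc_c D' n \oc fle n = f \oc wc_c D n) /\
    (forall i, triangle_morphism (wc_g D i) (wc_p D i) (wc_q D i)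
                 (wc_g D' i) (wc_p D' i) (wc_q D' i)
                 (fle (- (i + 1))) (fle (- i))
                 (fmap (tshift C (- i)) (heart_hom (m i)))).

(* A weight complex functor: choices for all objects, and for each morphism f
   the class of a chain map obtained from f. As this class does not depend on
   the choices made for f, functoriality and additivity are consequences and
   are not required here. *)
Record weight_complex_functor := WeightComplexFunctor {
  wcf_data : forall M, weight_complex_data M;
  wcf_ob : C -> Kweak Hw := fun M => wc_complex (wcf_data M);
  wcf_map : forall M M', mor M M' -> mor (wcf_ob M) (wcf_ob M');
  wcf_mapP : forall M M' (f : mor M M'),
    exists m : chain_map (wc_complex (wcf_data M)) (wc_complex (wcf_data M')),
      weight_complex_map f m /\
      wcf_map f = cls (weakly_null_ideal Hw) m }.

Definition degenerate (t : weight_complex_functor) M : Prop :=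
  is_zero (wcf_ob t M).

End WeightStructure.

Coercion wcf_ob : weight_complex_functor >-> Funclass.

(* Main.v *)
(* A morphism f : M -> M' kills weight m if every composite A -> M -> M' -> B
   with A in C_{w <= m} and B in C_{w >= m} vanishes.  A chain map obtained from
   f has the form d x + y d in degree -m exactly when f kills weight m; so M is
   degenerate if and only if its identity kills all weights, which yields I.2 at
   once.

   For I.1, let E be a cone of w_{<= m-1} M -> w_{<= m} M'.  The octahedral axiom,
   applied to the two factorizations of this morphism, provides
   e : M^{-m}[m] -> E and v : E -> M'^{-m}[m] such that v e can be chosen as the
   component of t(g) in degree -m, and E maps to Z = Cone(g) as w_{<= m} Z would.
   With u : E -> M^{1-m}[m], the pair (u, v) is a universal cycle of the cone of
   t(g), and Z kills weight m if and only if this cycle is a boundary.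

   For I.3, t(M) is computed from weight decompositions that are constant in the
   range concerned.  For II, if the identity of M kills weight m, then splitting
   the idempotent d x of M^{-m} gives a triangle A -> M -> R with A in
   C_{w <= m-1} and R in C_{w >= m+1}; by orthogonality the terms of such
   triangles for different m are retracts of each other, so that R (resp. A) is
   degenerate as soon as all weights above (resp. below) m are killed. *)

From Pilot Require Import Defs.
From HB Require Import structures.
From mathcomp Require Import all_boot all_order all_algebra.
From mathcomp Require Import boolp zify.
(* Again, since [ssrfun] shadows [compA]. *)
Import Pilot.Defs.

Set Implicit Arguments.
Unset Strict Implicit.
Unset Printing Implicit Defensive.

Import Order.TTheory GRing.Theory.
Local Open Scope ring_scope.
Local Open Scope cat_scope.

(** * Preadditive categories *)

Section Preadditive.
Variable C : preadditive.
Implicit Types X Y Z : C.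

Lemma compBl X Y Z (g g' : mor Y Z) (f : mor X Y) :
  (g - g') \oc f = g \oc f - g' \oc f.
Proof. by rewrite compDl compNm. Qed.

Lemma compBr X Y Z (g : mor Y Z) (f f' : mor X Y) :
  g \oc (f - f') = g \oc f - g \oc f'.
Proof. by rewrite compDr compmN. Qed.

Lemma iso1 X : is_iso (idm X).
Proof. by exists (idm X); rewrite comp1m. Qed.

Lemma is_isoM X Y Z (g : mor Y Z) (f : mor X Y) :
  is_iso g -> is_iso f -> is_iso (g \oc f).
Proof.
move=> [g' [g'g gg']] [f' [f'f ff']]; exists (f' \oc g'); split.
  by rewrite compA -(compA f') g'g compm1.
by rewrite compA -(compA g) ff' compm1.
Qed.

Lemma is_isoN X Y (f : mor X Y) : is_iso f -> is_iso (- f).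
Proof.
by case=> g [gf fg]; exists (- g); rewrite !(compNm, compmN) !opprK.
Qed.

Lemma isomorphic_sym X Y : isomorphic X Y -> isomorphic Y X.
Proof. by case=> f [g [gf fg]]; exists g, f. Qed.

Lemma isomorphic_trans X Y Z : isomorphic X Y -> isomorphic Y Z -> isomorphic X Z.
Proof. by case=> f fI [g gI]; exists (g \oc f); apply: is_isoM. Qed.

Lemma isomorphic_retract X Y : isomorphic X Y -> retract_of X Y.
Proof. by case=> f [g [gf fg]]; exists f, g. Qed.

Lemma retract_trans X Y Z : retract_of X Y -> retract_of Y Z -> retract_of X Z.
Proof.
case=> s [r rs] [s' [r' rs']]; exists (s' \oc s), (r \oc r').
by rewrite compA -(compA r) rs' compm1.
Qed.

Lemma iso_inj X Y Z (f : mor Y Z) (u v : mor X Y) :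
  is_iso f -> f \oc u = f \oc v -> u = v.
Proof. by case=> g [gf _] E; rewrite -[u]comp1m -[v]comp1m -gf -!compA E. Qed.

Lemma iso_surj X Y Z (f : mor X Y) (u v : mor Y Z) :
  is_iso f -> u \oc f = v \oc f -> u = v.
Proof. by case=> g [_ fg] E; rewrite -[u]compm1 -[v]compm1 -fg !compA E. Qed.

Lemma is_zeroP X : is_zero X <-> idm X = 0.
Proof.
split=> [/(_ X)[E _] | X0 Y]; first exact: E.
by split=> f; [rewrite -[f]compm1 X0 compm0 | rewrite -[f]comp1m X0 comp0m].
Qed.

End Preadditive.

Section FullyFaithful.
Variables C D : preadditive.
Implicit Type F : functor C D.

Definition faithful F := forall X Y (f g : mor X Y), fmap F f = fmap F g -> f = g.

Definition full F := forall X Y (u : mor (F X) (F Y)), exists f, fmap F f = u.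

Lemma fmap0 F X Y : fmap F (0 : mor X Y) = 0.
Proof. by apply: (@addrI _ (fmap F 0)); rewrite -fmapD !addr0. Qed.

Lemma fmapN F X Y (f : mor X Y) : fmap F (- f) = - fmap F f.
Proof. by apply: (@addrI _ (fmap F f)); rewrite -fmapD !subrr fmap0. Qed.

Lemma fmapB F X Y (f g : mor X Y) : fmap F (f - g) = fmap F f - fmap F g.
Proof. by rewrite fmapD fmapN. Qed.

Lemma fmap_iso F X Y (f : mor X Y) : is_iso f -> is_iso (fmap F f).
Proof. by case=> g [gf fg]; exists (fmap F g); rewrite -!fmapM gf fg !fmap1. Qed.

Lemma fmap_isomorphic F X Y : isomorphic X Y -> isomorphic (F X) (F Y).
Proof. by case=> f fI; exists (fmap F f); apply: fmap_iso. Qed.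

Lemma retract_reflect F X Y : full F -> faithful F ->
  retract_of (F X) (F Y) -> retract_of X Y.
Proof.
move=> Ff Fi [s [r]]; have [s' <-] := Ff _ _ s; have [r' <-] := Ff _ _ r.
by rewrite -fmapM -fmap1 => /Fi rs; exists s', r'.
Qed.

Lemma isomorphic_reflect F X Y : full F -> faithful F ->
  isomorphic (F X) (F Y) -> isomorphic X Y.
Proof.
move=> Ff Fi [s [r []]]; have [s' <-] := Ff _ _ s; have [r' <-] := Ff _ _ r.
by rewrite -!fmapM -!fmap1 => /Fi rs /Fi sr; exists s', r'.
Qed.

End FullyFaithful.

(** * Triangulated categories *)

Section Shift.
Variable C : triangulated.
Implicit Types X Y Z : C.

Lemma sh_faithful : faithful (@sh C).
Proof.
move=> X Y f g E; apply: (iso_inj (sh_unit_iso Y)).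
by rewrite !sh_unit_nat E.
Qed.

Lemma ush_faithful : faithful (@ush C).
Proof.
move=> X Y f g E; apply: (iso_surj (sh_counit_iso X)).
by rewrite !sh_counit_nat E.
Qed.

Lemma sh_full : full (@sh C).
Proof.
move=> X Y u; have [v [vK Kv]] := sh_unit_iso Y.
exists (v \oc fmap ush u \oc sh_unit X); apply: ush_faithful.
apply: (iso_surj (sh_unit_iso X)).
by rewrite -sh_unit_nat !compA Kv comp1m.
Qed.

Lemma ush_full : full (@ush C).
Proof.
move=> X Y u; have [v [vK Kv]] := sh_counit_iso X.
exists (sh_counit Y \oc fmap sh u \oc v); apply: sh_faithful.
apply: (iso_inj (sh_counit_iso Y)).
by rewrite -sh_counit_nat -!compA vK compm1.
Qed.

Lemma iter_full (F : functor C C) n : full F -> full (iter_functor F n).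
Proof.
move=> Ff; elim: n => [|n IHn] X Y u; first by exists u.
have [v <-] := Ff _ _ u; have [w <-] := IHn _ _ v; by exists w.
Qed.

Lemma iter_faithful (F : functor C C) n : faithful F -> faithful (iter_functor F n).
Proof. by move=> Fi; elim: n => [|n IHn] X Y f g //= /Fi /IHn. Qed.

Lemma tshift_full n : full (tshift C n).
Proof. by case: n => n; apply: iter_full; [apply: sh_full | apply: ush_full]. Qed.

Lemma tshift_faithful n : faithful (tshift C n).
Proof.
by case: n => n; apply: iter_faithful; [apply: sh_faithful | apply: ush_faithful].
Qed.

Lemma sh_surj X : exists Y, isomorphic X (sh Y).
Proof. by exists (ush X); apply: isomorphic_sym; eexists; apply: sh_counit_iso. Qed.

Lemma shift_iso_iso k m (e : k + 1 = m) X : is_iso (shift_iso e X).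
Proof.
rewrite /shift_iso; move: (etrans _ e) => {e} e; case: m / e => /=.
by case: k => [k|[|k]] /=; [apply: iso1 | apply: sh_counit_iso..].
Qed.

Lemma shift_iso_nat k m (e : k + 1 = m) X Y (f : mor X Y) :
  fmap (tshift C m) f \oc shift_iso e X =
  shift_iso e Y \oc fmap sh (fmap (tshift C k) f).
Proof.
rewrite /shift_iso; move: (etrans _ e) => {e} e; case: m / e => /=.
by case: k => [k|[|k]] /=; rewrite ?comp1m ?compm1 ?sh_counit_nat.
Qed.

Lemma sh_tshift k X : isomorphic (sh (tshift C k X)) (tshift C (k + 1) X).
Proof. by exists (shift_iso erefl X); apply: shift_iso_iso. Qed.

End Shift.

(** The step is an equivalence because integers are reached from 0 in both directions; facts about
    $\mathcal C_{w\le n}$ and $\mathcal C_{w\ge n}$ are carried along [sh] both ways. *)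
Lemma int_shift_ind (P : int -> Prop) :
  P 0 -> (forall i, P i <-> P (i + 1)) -> forall i, P i.
Proof.
move=> P0 PS; case=> n.
  elim: n => [//|n /PS]; congr P; lia.
elim: n => [|n IHn]; first by apply/PS.
by apply/PS; move: IHn; congr P; lia.
Qed.

Section Triangles.
Variable C : triangulated.
Implicit Types X Y Z A B : C.

Section Exact.
Variables (X Y Z : C) (f : mor X Y) (g : mor Y Z) (h : mor Z (sh X)).
Hypothesis D : dist f g h.

(** Completing [a] and 0 to a morphism between the rotations of the identity triangle of [A] and of
    [D] gives a map $A[1]\to X[1]$; it desuspends by fullness of [sh], and the two rotation signs
    cancel. *)
Lemma tri_lift1 A (a : mor A Y) : g \oc a = 0 -> exists b, a = f \oc b.
Proof.
move=> ga0; have [O O0] := (tcat_additive C).1.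
have /dist_rot DA := dist_id A O0; have /dist_rot DX := D.
have [|c [_ E]] := @dist_complete C _ _ _ _ _ _ _ _ _ _ _ _ a 0 DA DX.
  by rewrite comp0m.
have [b cE] := sh_full c; exists b; apply: sh_faithful.
rewrite fmapM cE; apply: oppr_inj.
by rewrite -compNm -E fmap1 compmN compm1.
Qed.

Lemma tri_comp1 : g \oc f = 0.
Proof.
have [O O0] := (tcat_additive C).1.
have [|c [E _]] := @dist_complete C _ _ _ _ _ _ _ _ _ _ _ _ (idm X) f
  (dist_id X O0) D; first by [].
by rewrite -E compm0.
Qed.

End Exact.

Section Exact2.
Variables (X Y Z : C) (f : mor X Y) (g : mor Y Z) (h : mor Z (sh X)).
Hypothesis D : dist f g h.

Lemma tri_comp2 : h \oc g = 0.
Proof. by apply: (tri_comp1 (iffLR (dist_rot _ _ _) D)). Qed.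

Lemma tri_comp3 : fmap sh f \oc h = 0.
Proof.
apply: oppr_inj; rewrite oppr0 -compNm.
exact: (tri_comp1 (iffLR (dist_rot _ _ _) (iffLR (dist_rot _ _ _) D))).
Qed.

Lemma tri_lift2 A (a : mor A Z) : h \oc a = 0 -> exists b, a = g \oc b.
Proof. exact: (tri_lift1 (iffLR (dist_rot _ _ _) D)). Qed.

Lemma tri_lift3 A (a : mor A (sh X)) : fmap sh f \oc a = 0 -> exists b, a = h \oc b.
Proof.
move=> fa0.
apply: (tri_lift1 (iffLR (dist_rot _ _ _) (iffLR (dist_rot _ _ _) D))).
by rewrite compNm fa0 oppr0.
Qed.

Lemma tri_ext1 B (b : mor Y B) : b \oc f = 0 -> exists a, b = a \oc g.
Proof.
move=> bf0; have [O O0] := (tcat_additive C).1.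
have DB : dist (0 : mor O B) (idm B) 0.
  apply/dist_rot; rewrite fmap0 oppr0; apply: dist_id.
  by apply/is_zeroP; rewrite -fmap1 (iffLR (is_zeroP _) O0) fmap0.
have [|a [E _]] := @dist_complete C _ _ _ _ _ _ _ _ _ _ _ _ 0 b D DB.
  by rewrite bf0 compm0.
by exists a; rewrite E comp1m.
Qed.

End Exact2.

Section Exact3.
Variables (X Y Z : C) (f : mor X Y) (g : mor Y Z) (h : mor Z (sh X)).
Hypothesis D : dist f g h.

Lemma tri_ext2 B (b : mor Z B) : b \oc g = 0 -> exists a, b = a \oc h.
Proof. exact: (tri_ext1 (iffLR (dist_rot _ _ _) D)). Qed.

Lemma tri_ext3 B (b : mor (sh X) B) : b \oc h = 0 -> exists a, b = a \oc fmap sh f.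
Proof.
move=> /(tri_ext1 (iffLR (dist_rot _ _ _) (iffLR (dist_rot _ _ _) D)))[a ->].
by exists (- a); rewrite compNm compmN.
Qed.

Lemma tri_ext4 B (b : mor (sh Y) B) :
  b \oc fmap sh f = 0 -> exists a, b = a \oc fmap sh g.
Proof.
move=> bf0.
have D3 := iffLR (dist_rot _ _ _) (iffLR (dist_rot _ _ _) (iffLR (dist_rot _ _ _) D)).
have [|a ->] := tri_ext1 D3 (b := b); first by rewrite compmN bf0 oppr0.
by exists (- a); rewrite compNm compmN.
Qed.

(** Stating the factorization after a shift avoids choosing a desuspension of [Z]. *)
Lemma tri_desuspend A (a : mor A X) : f \oc a = 0 ->
  exists b, fmap sh a = h \oc b.
Proof. by move=> fa0; apply: (tri_lift3 D); rewrite -fmapM fa0 fmap0. Qed.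

End Exact3.

Lemma dist_sh X Y Z (f : mor X Y) (g : mor Y Z) (h : mor Z (sh X)) :
  dist f g h <-> dist (- fmap sh f) (- fmap sh g) (- fmap sh h).
Proof.
by split=> [/dist_rot/dist_rot/dist_rot | D]; last do 3![apply/dist_rot].
Qed.

Lemma dist_signs X Y Z (f : mor X Y) (g : mor Y Z) (h : mor Z (sh X)) :
  dist f g h <-> dist (- f) (- g) h.
Proof.
have N1 (A : C) : is_iso (- idm A) by apply/is_isoN/iso1.
split; apply: (dist_iso (iso1 _) (N1 _) (iso1 _)).
- by rewrite compNm comp1m compm1.
- by rewrite comp1m !compmN compNm compm1 opprK.
- by rewrite fmap1 comp1m compm1.
- by rewrite !compNm compmN comp1m compm1 opprK.
- by rewrite comp1m compmN compm1.
- by rewrite fmap1 comp1m compm1.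
Qed.

End Triangles.

(** * Weight structures *)

Section ShiftClass.
Variables (C : triangulated) (P : C -> Prop).
Hypothesis P_retract : closed_retracts P.
Implicit Types X Y : C.

Lemma shift_class_iso n X Y :
  isomorphic X Y -> shift_class P n X -> shift_class P n Y.
Proof.
move=> XY [Z [PZ XZ]]; exists Z; split=> //.
exact: isomorphic_trans (isomorphic_sym XY) XZ.
Qed.

Lemma shift_class0 X : shift_class P 0 X <-> P X.
Proof.
split=> [[Y [PY /isomorphic_retract XY]] | PX]; first exact: P_retract XY PY.
by exists X; split=> //; exists (idm X); apply: iso1.
Qed.

Lemma shift_class_retract n : closed_retracts (shift_class P n).
Proof.
move=> X Y XY [Z [PZ YZ]].
have [X' XX'] : exists X', isomorphic X (tshift C n X').
  elim/int_shift_ind: n X {Y Z XY PZ YZ} => [X|n].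
    by exists X, (idm X); apply: iso1.
  split=> IH X; last first.
    have [X' XX'] := IH (sh X); exists X'.
    apply: (isomorphic_reflect (@sh_full C) (@sh_faithful C)).
    exact: isomorphic_trans XX' (isomorphic_sym (sh_tshift n X')).
  have [Y XY] := sh_surj X; have [X' YX'] := IH Y; exists X'.
  apply: isomorphic_trans XY _.
  exact: isomorphic_trans (fmap_isomorphic sh YX') (sh_tshift n X').
exists X'; split=> //; apply: P_retract PZ.
apply: (retract_reflect (@tshift_full C n) (@tshift_faithful C n)).
apply: retract_trans (isomorphic_retract (isomorphic_sym XX')) _.
exact: retract_trans XY (isomorphic_retract YZ).
Qed.

Lemma shift_class_sh n X : shift_class P n X <-> shift_class P (n + 1) (sh X).
Proof.
split=> -[Y [PY XY]]; exists Y; split=> //.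
  exact: isomorphic_trans (fmap_isomorphic sh XY) (sh_tshift n Y).
apply: (isomorphic_reflect (@sh_full C) (@sh_faithful C)).
exact: isomorphic_trans XY (isomorphic_sym (sh_tshift n Y)).
Qed.

Lemma shift_class_tshift n X : P X -> shift_class P n (tshift C n X).
Proof. by move=> PX; exists X; split=> //; exists (idm _); apply: iso1. Qed.

Lemma shift_class_reflect n X : shift_class P n (tshift C n X) -> P X.
Proof.
case=> Y [PY /(isomorphic_reflect (@tshift_full C n) (@tshift_faithful C n))].
by move=> /isomorphic_retract XY; apply: P_retract XY PY.
Qed.

End ShiftClass.

Section Weights.
Variables (C : triangulated) (w : weight_structure C).
Implicit Types (L M R A B X Y Z : C) (m n : int).

Lemma wle_retract m : closed_retracts (wle w m).
Proof. exact/shift_class_retract/wle0_retract. Qed.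

Lemma wge_retract m : closed_retracts (wge w m).
Proof. exact/shift_class_retract/wge0_retract. Qed.

Lemma wle_iso m X Y : isomorphic X Y -> wle w m X -> wle w m Y.
Proof. exact: shift_class_iso. Qed.

Lemma wge_iso m X Y : isomorphic X Y -> wge w m X -> wge w m Y.
Proof. exact: shift_class_iso. Qed.

Lemma wle_sh m X : wle w m X -> wle w (m + 1) (sh X).
Proof. by move/shift_class_sh. Qed.

Lemma wle_unsh m X : wle w (m + 1) (sh X) -> wle w m X.
Proof. by move=> H; apply/shift_class_sh. Qed.

Lemma wge_sh m X : wge w m X -> wge w (m + 1) (sh X).
Proof. by move/shift_class_sh. Qed.

Lemma wge_unsh m X : wge w (m + 1) (sh X) -> wge w m X.
Proof. by move=> H; apply/shift_class_sh. Qed.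

Lemma wle_le m n X : (m <= n)%R -> wle w m X -> wle w n X.
Proof.
have wleS k : forall X, wle w k X -> wle w (k + 1) X.
  elim/int_shift_ind: k => [Y|k].
    by move/(shift_class0 (@wle0_retract _ w))/wle0_shift.
  split=> IH Y; last by move/wle_sh/IH/wle_unsh.
  have [Y' YY'] := sh_surj Y => /(wle_iso YY')/wle_unsh/IH/wle_sh.
  exact: wle_iso (isomorphic_sym YY').
move=> mn; have [k ->] : exists k : nat, n = m + k%:Z.
  by exists `|n - m|%N; lia.
elim: k => [|k IHk]; first by rewrite addr0.
by move=> /IHk /wleS; have -> : m + k.+1%:Z = m + k%:Z + 1 by lia.
Qed.

Lemma wge_le m n X : (m <= n)%R -> wge w n X -> wge w m X.
Proof.
have wgeS k : forall X, wge w (k + 1) X -> wge w k X.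
  elim/int_shift_ind: k => [Y|k].
    by move/wge0_shift/(shift_class0 (@wge0_retract _ w)).
  split=> IH Y; last by move/wge_sh/IH/wge_unsh.
  have [Y' YY'] := sh_surj Y => /(wge_iso YY')/wge_unsh/IH/wge_sh.
  exact: wge_iso (isomorphic_sym YY').
move=> mn; have [k ->] : exists k : nat, n = m + k%:Z.
  by exists `|n - m|%N; lia.
elim: k => [|k IHk]; first by rewrite addr0.
have -> : m + k.+1%:Z = m + k%:Z + 1 by lia.
by move=> H; apply/IHk/wgeS.
Qed.

Lemma w_orthogonal m n A B (f : mor A B) :
  (m < n)%R -> wle w m A -> wge w n B -> f = 0.
Proof.
move=> mn Am Bn; have {n mn Bn}Bm : wge w (m + 1) B by by apply: wge_le Bn; lia.
elim/int_shift_ind: m A B f Am Bm => [A B f Am Bm|m].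
  exact: w_orth (iffLR (shift_class0 (@wle0_retract _ w) A) Am) Bm f.
split=> IH A B f Am Bm; last first.
  apply: sh_faithful; rewrite fmap0; apply: IH; first exact/wle_sh.
  exact/wge_sh.
have [A' AA'] := sh_surj A; have [B' BB'] := sh_surj B.
have Am' := wle_unsh (wle_iso AA' Am).
have Bm' := wge_unsh (wge_iso BB' Bm).
case: BB' => b bI; case: AA' => a [a' [a'a aa']].
have [f' f'E] := sh_full (b \oc f \oc a').
apply: (iso_inj bI); rewrite compm0 -[LHS]compm1 -a'a compA -f'E.
by rewrite (IH _ _ f') // fmap0 comp0m.
Qed.

Lemma weight_decomposition_exists m M :
  exists L (c : mor L M), weight_decomposition w m c.
Proof.
elim/int_shift_ind: m M => [M|m].
  have [L [R [a [b [c [Lw Rw D]]]]]] := w_decomp w M.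
  exists L, a, R, b, c; split=> //.
  exact/(shift_class0 (@wle0_retract _ w)).
split=> IH M.
  have [M' /isomorphic_sym[u uI]] := sh_surj M; have [u' [u'u uu']] := uI.
  have [L [c [R [b [e [Lw Rw /dist_sh D]]]]]] := IH M'.
  exists (sh L), (- (u \oc fmap sh c)), (sh R), (- (fmap sh b \oc u')), (- fmap sh e).
  split; [exact/wle_sh | exact/wge_sh |].
  apply: dist_iso (iso1 _) uI (iso1 _) _ _ _ D.
  - by rewrite compmN compm1.
  - by rewrite comp1m compNm -compA u'u compm1.
  - by rewrite fmap1 comp1m compm1.
have [L [c [R [b [e [Lw Rw D]]]]]] := IH (sh M).
have [L' LL'] := sh_surj L; have [R' RR'] := sh_surj R.
have Lw' := wle_unsh (wle_iso LL' Lw).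
have Rw' := wge_unsh (wge_iso RR' Rw).
case: LL' => u uI; have [u' [u'u uu']] := uI.
case: RR' => v vI; have [v' [v'v vv']] := vI.
have [c1 c1E] := sh_full (- (c \oc u')).
have [b1 b1E] := sh_full (- (v \oc b)).
have [e1 e1E] := sh_full (- (fmap sh u \oc e \oc v')).
exists L', c1, R', b1, e1; split=> //; apply/dist_sh.
rewrite c1E b1E e1E !opprK; apply: dist_iso uI (iso1 _) vI _ _ _ D.
- by rewrite comp1m -compA u'u compm1.
- by rewrite compm1.
- by rewrite -compA v'v compm1.
Qed.

(** The arrow from [A] to the right part of a decomposition vanishes, so the identity lifts and [A]
    is a retract of the left part. *)
Lemma wleP m A : (forall B (f : mor A B), wge w (m + 1) B -> f = 0) -> wle w m A.
Proof.
move=> A0; have [L [c [R [b [e [Lw Rw D]]]]]] := weight_decomposition_exists m A.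
have [|s sE] := tri_lift1 D (a := idm A); first by rewrite compm1 (A0 _ b).
by apply: wle_retract Lw; exists s, c.
Qed.

Lemma wgeP m B : (forall A (f : mor A B), wle w m A -> f = 0) -> wge w (m + 1) B.
Proof.
move=> B0; have [L [c [R [b [e [Lw Rw D]]]]]] := weight_decomposition_exists m B.
have [|r rE] := tri_ext1 D (b := idm B); first by rewrite comp1m (B0 _ c).
by apply: wge_retract Rw; exists b, r.
Qed.

Lemma wle_extension m X Y Z (f : mor X Y) (g : mor Y Z) (h : mor Z (sh X)) :
  dist f g h -> wle w m X -> wle w m Z -> wle w m Y.
Proof.
move=> D Xm Zm; apply: wleP => B b Bm.
have [|a ->] := tri_ext1 D (b := b); first by apply: w_orthogonal Xm Bm; lia.
by rewrite (@w_orthogonal m (m + 1) _ _ a) ?comp0m //; lia.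
Qed.

Lemma wle_cone m X Y Z (f : mor X Y) (g : mor Y Z) (h : mor Z (sh X)) :
  dist f g h -> wle w (m - 1) X -> wle w m Y -> wle w m Z.
Proof.
move=> /dist_rot D /wle_sh Xm Ym; apply: wle_extension D Ym _.
by move: Xm; rewrite subrK.
Qed.

Section Decomposition.
Variables (m : int) (L M : C) (c : mor L M).
Hypothesis cD : weight_decomposition w m c.

Lemma wd_wle : wle w m L.
Proof. by case: cD => R [b [e []]]. Qed.

Lemma wd_lift n A (a : mor A M) : (n <= m)%R -> wle w n A -> exists b, a = c \oc b.
Proof.
case: cD => R [b [e [Lw Rw D]]] nm An; apply: (tri_lift1 D).
by apply: w_orthogonal An Rw; lia.
Qed.

(** After a shift the difference factors through the part of weight at least $m+1$, while $A[1]$ has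
    weight at most $n+1$. This forces $n<m$, whereas [wd_lift] allows $n=m$. *)
Lemma wd_inj n A (a b : mor A L) : (n < m)%R -> wle w n A -> c \oc a = c \oc b -> a = b.
Proof.
case: cD => R [r [e [Lw Rw D]]] nm An E; apply: subr0_eq.
have [|d dE] := tri_desuspend D (a := a - b); first by rewrite compBr E subrr.
apply: sh_faithful; rewrite fmap0 dE (@w_orthogonal (n + 1) (m + 1) _ _ d) ?compm0 //.
  lia.
exact/wle_sh.
Qed.

End Decomposition.

Definition kills_weight m M M' (f : mor M M') :=
  forall A B (a : mor A M) (b : mor M' B),
    wle w m A -> wge w m B -> b \oc f \oc a = 0.

(** Maps into [M] from weight at most $m$ lift along [c], so testing [f \oc c] against the right
    part of [c'] suffices. The separate [n] admits indices such as [- (i + 1 + 1)] as they stand. *)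
Lemma kills_weightP m n M M' (f : mor M M') L L' (c : mor L M) (c' : mor L' M') :
  weight_decomposition w m c -> weight_decomposition w n c' -> (n + 1 = m)%R ->
  kills_weight m f <-> exists s : mor L L', f \oc c = c' \oc s.
Proof.
move=> cD c'D nm; split=> [fK | [s sE] A B a b Am Bm].
  case: (c'D) => R [b [e [Lw Rw D]]]; apply: (tri_lift1 D).
  by rewrite compA; apply: fK; [apply: wd_wle cD | rewrite -nm].
have [a' ->] := wd_lift cD a (lexx m) Am.
rewrite -compA [f \oc _]compA sE !compA.
rewrite (@w_orthogonal n m _ _ (b \oc c')) ?comp0m //; first lia.
exact: wd_wle c'D.
Qed.

End Weights.

(** * Weight complexes and killing weights *)

Lemma dep_choice (I : Type) (T : I -> Type) (P : forall i, T i -> Prop) :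
  (forall i, exists x, P i x) -> exists f : forall i, T i, forall i, P i (f i).
Proof.
by move=> H; exists (fun i => projT1 (cid (H i))) => i; apply: (projT2 (cid (H i))).
Qed.

(** A family built in degrees [i + 1] covers all integers only after transport along
    [j - 1 + 1 = j]; uniqueness of equality proofs between integers removes the transport. *)
Lemma int_reindex (T : int -> Type) (F : forall i, T (i + 1)) :
  exists G : forall j, T j, forall i, G (i + 1) = F i.
Proof.
exists (fun j => eq_rect _ T (F (j - 1)) j (subrK 1 j)) => i.
have eqF k (e : k + 1 = i + 1) : eq_rect (k + 1) T (F k) (i + 1) e = F i.
  by have ki := addIr _ e; subst k; rewrite eq_axiomK.
exact: eqF.
Qed.

Section Heart.
Variables (C : triangulated) (w : weight_structure C).
Implicit Types (A B : Hw w) (j : int).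

(* [hsh j A] is A[-j], the position of a term of degree j in a weight complex. *)
Definition hsh j A : C := tshift C (- j) (heart_ob A).

Definition hshm j A B (f : mor A B) : mor (hsh j A) (hsh j B) :=
  fmap (tshift C (- j)) (heart_hom f).

Definition hsh_succ j A : mor (sh (hsh (j + 1) A)) (hsh j A) :=
  shift_iso (shift_degree j) (heart_ob A).

Lemma hsh_wge j A : wge w (- j) (hsh j A).
Proof.
apply: shift_class_tshift; have [Aw _] := svalP A.
exact: (iffLR (shift_class0 (@wge0_retract _ w) _) Aw).
Qed.

Lemma hshm1 j A : hshm j (idm A) = idm (hsh j A).
Proof. exact: fmap1. Qed.

Lemma hshmM j A B E (g : mor B E) (f : mor A B) :
  hshm j (g \oc f) = hshm j g \oc hshm j f.
Proof. exact: fmapM. Qed.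

Lemma hshmD j A B (f g : mor A B) : hshm j (f + g) = hshm j f + hshm j g.
Proof. exact: fmapD. Qed.

Lemma hshmN j A B (f : mor A B) : hshm j (- f) = - hshm j f.
Proof. exact: fmapN. Qed.

Lemma hshmB j A B (f g : mor A B) : hshm j (f - g) = hshm j f - hshm j g.
Proof. exact: fmapB. Qed.

Lemma hshm0 j A B : hshm j (0 : mor A B) = 0.
Proof. exact: fmap0. Qed.

Lemma hshm_inj j A B (f g : mor A B) : hshm j f = hshm j g -> f = g.
Proof. exact: tshift_faithful. Qed.

Lemma hshm_full j A B (u : mor (hsh j A) (hsh j B)) : exists f, hshm j f = u.
Proof. exact: (@tshift_full C (- j) _ _ u). Qed.

Lemma hsh_succ_iso j A : is_iso (hsh_succ j A).
Proof. exact: shift_iso_iso. Qed.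

Lemma hsh_succ_nat j A B (f : mor A B) :
  hshm j f \oc hsh_succ j A = hsh_succ j B \oc fmap sh (hshm (j + 1) f).
Proof. exact: shift_iso_nat. Qed.

End Heart.

Arguments wc_le {C w M} D n : rename.
Arguments wc_c {C w M} D n : rename.
Arguments wc_cP {C w M} D n : rename.
Arguments wc_g {C w M} D i : rename.
Arguments wc_gP {C w M} D i : rename.
Arguments wc_p {C w M} D i : rename.
Arguments wc_q {C w M} D i : rename.
Arguments wc_dist {C w M} D i : rename.

Section Tower.
Variables (C : triangulated) (w : weight_structure C) (M : C).
Variable D : weight_complex_data w M.
Local Notation X := (wc_complex D).
Implicit Types (A B T : C) (i j : int).

Lemma wc_wle n : wle w n (wc_le D n).
Proof. exact: wd_wle (wc_cP D n). Qed.

Definition wc_p2 j : mor (sh (wc_le D (- (j + 1)))) (hsh j (X (j + 1))) :=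
  locked (hsh_succ j (X (j + 1)) \oc fmap sh (wc_p D (j + 1))).

Lemma wc_p2E j : wc_p2 j = hsh_succ j (X (j + 1)) \oc fmap sh (wc_p D (j + 1)).
Proof. by rewrite /wc_p2 -lock. Qed.

Lemma wc_diffE j : hshm j (cdiff X j) = wc_p2 j \oc wc_q D j.
Proof. by rewrite /hshm wc_diff wc_p2E -compA. Qed.

Lemma wc_ext1 j T (u : mor (wc_le D (- j)) T) : wge w (- j) T ->
  exists a, u = a \oc wc_p D j.
Proof.
move=> Tw; apply: (tri_ext1 (wc_dist D j)).
by apply: w_orthogonal (wc_wle _) Tw; lia.
Qed.

Lemma wc_ext2 j T (u : mor (sh (wc_le D (- (j + 1)))) T) : wge w (- j) T ->
  exists a, u = a \oc wc_p2 j.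
Proof.
move=> Tw; have [|a ->] := tri_ext4 (wc_dist D (j + 1)) (b := u).
  by apply: w_orthogonal (wle_sh (wc_wle _)) Tw; lia.
have [s [sK Ks]] := hsh_succ_iso j (X (j + 1)).
by exists (a \oc s); rewrite wc_p2E !compA -(compA a) sK compm1.
Qed.

(** For targets of weight at least $-j$, $d^j$ is a weak cokernel of [wc_p D j]: the map factors
    through [wc_q D j], and the remaining factor extends along [wc_p2] by orthogonality. *)
Lemma wc_extd j T (u : mor (hsh j (X j)) T) : wge w (- j) T ->
  u \oc wc_p D j = 0 -> exists a, u = a \oc hshm j (cdiff X j).
Proof.
move=> Tw u0; have [b uE] := tri_ext2 (wc_dist D j) u0.
have [a bE] := wc_ext2 b Tw; exists a; by rewrite uE bE wc_diffE compA.
Qed.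

(** The analogue of [wc_extd] for $d^{j+1}$, with everything shifted by one; working with shifted
    triangles avoids desuspending [T]. *)
Lemma wc_extd2 j T (u : mor (hsh j (X (j + 1))) T) : wge w (- j) T ->
  u \oc wc_p2 j = 0 -> exists a, u = a \oc hshm j (cdiff X (j + 1)).
Proof.
move=> Tw; rewrite wc_p2E compA => u0.
have [a aE] := tri_ext4 (iffLR (dist_rot _ _ _) (wc_dist D (j + 1))) u0.
have [|b bE] := tri_ext4 (iffLR (dist_sh _ _ _) (wc_dist D (j + 1 + 1))) (b := a).
  by apply: w_orthogonal (wle_sh (wle_sh (wc_wle _))) Tw; lia.
have sI := hsh_succ_iso j (X (j + 1)).
have [s' [s'K Ks']] := hsh_succ_iso (j + 1) (X (j + 1 + 1)).
have [s2 [s2K Ks2]] := hsh_succ_iso j (X (j + 1 + 1)).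
exists (- b \oc fmap sh s' \oc s2); apply: (iso_surj sI).
rewrite aE bE -[RHS]compA hsh_succ_nat [RHS]compA -[_ \oc s2 \oc _]compA s2K compm1.
rewrite -[RHS]compA -fmapM wc_diffE wc_p2E !compA s'K comp1m.
by rewrite fmapN !(compmN, compNm) fmapM compA.
Qed.

Lemma wc_diff_p j : hshm j (cdiff X j) \oc wc_p D j = 0.
Proof. by rewrite wc_diffE -compA (tri_comp2 (wc_dist D j)) compm0. Qed.

Lemma wc_diff_p2 j : hshm j (cdiff X (j + 1)) \oc wc_p2 j = 0.
Proof.
by rewrite wc_p2E compA hsh_succ_nat -compA -fmapM wc_diff_p fmap0 compm0.
Qed.

(* The desuspension of the arrow [wc_q D i]; it is only available in degrees of
   the form i + 1. *)
Lemma wc_q0_exists i : exists q0 : mor (hsh (i + 1) (X i)) (wc_le D (- (i + 1))),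
  [/\ hshm (i + 1) (cdiff X i) = wc_p D (i + 1) \oc q0,
      wc_c D (- (i + 1)) \oc q0 = 0
    & forall A (a : mor A (wc_le D (- (i + 1)))), wle w (- (i + 1)) A ->
        wc_c D (- (i + 1)) \oc a = 0 -> exists b, a = q0 \oc b].
Proof.
have [q0 q0E] := sh_full (wc_q D i \oc hsh_succ i (X i)).
exists q0; split.
- apply: sh_faithful; apply: (iso_inj (hsh_succ_iso i (X (i + 1)))).
  by rewrite -hsh_succ_nat fmapM q0E wc_diffE wc_p2E !compA.
- rewrite -wc_gP -compA; suff -> : wc_g D i \oc q0 = 0 by rewrite compm0.
  by apply: sh_faithful; rewrite fmapM q0E compA (tri_comp3 (wc_dist D i)) comp0m fmap0.
move=> A a Aw; rewrite -wc_gP -compA => ca0.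
have ga0 : wc_g D i \oc a = 0.
  apply: (wd_inj (wc_cP D (- i)) _ Aw); first lia.
  by rewrite ca0 compm0.
have [b bE] := tri_desuspend (wc_dist D i) ga0.
have [s [sK Ks]] := hsh_succ_iso i (X i).
have [b' b'E] := sh_full (s \oc b); exists b'; apply: sh_faithful.
by rewrite fmapM b'E q0E compA -(compA _ _ s) Ks compm1.
Qed.

End Tower.

(** * Null components of a chain map and killed weights *)

Section Nullity.
Variables (C : triangulated) (w : weight_structure C) (M M' : C).
Variables (D : weight_complex_data w M) (D' : weight_complex_data w M').
Variables (f : mor M M') (fle : forall n, mor (wc_le D n) (wc_le D' n)).
Variable m : forall i, mor (wc_complex D i) (wc_complex D' i).
Hypothesis fleP : forall n, wc_c D' n \oc fle n = f \oc wc_c D n.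
Hypothesis mP : forall i,
  triangle_morphism (wc_g D i) (wc_p D i) (wc_q D i)
    (wc_g D' i) (wc_p D' i) (wc_q D' i)
    (fle (- (i + 1))) (fle (- i)) (hshm i (m i)).
Local Notation X := (wc_complex D).
Local Notation Y := (wc_complex D').

Lemma wc_map_p j : hshm j (m j) \oc wc_p D j = wc_p D' j \oc fle (- j).
Proof. by have [] := mP j. Qed.

Lemma wc_map_q j :
  fmap sh (fle (- (j + 1))) \oc wc_q D j = wc_q D' j \oc hshm j (m j).
Proof. by have [] := mP j. Qed.

Lemma wc_map_p2 j : hshm j (m (j + 1)) \oc wc_p2 D j
  = wc_p2 D' j \oc fmap sh (fle (- (j + 1))).
Proof.
by rewrite !wc_p2E compA hsh_succ_nat -!compA -!fmapM wc_map_p.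
Qed.

Lemma wc_map_chain j : m (j + 1) \oc cdiff X j = cdiff Y j \oc m j.
Proof.
apply: (@hshm_inj _ _ j); rewrite !hshmM !wc_diffE compA wc_map_p2.
by rewrite -!compA wc_map_q.
Qed.

(** Given [x] and [y], the summand [y d] dies on [wc_p], and [d x] passes through [q0], which dies
    in [M']. Conversely, killing the weight lets [fle] be corrected by a map through $w_{\le
    -(i+2)}M'$ until it dies in [M']; it then factors through [q0], which gives [x], and [wc_extd]
    applied to [m - d x] gives [y]. *)
Lemma weakly_null_at i :
  (exists (x : mor (X (i + 1)) (Y i)) (y : mor (X (i + 1 + 1)) (Y (i + 1))),
     m (i + 1) = cdiff Y i \oc x + y \oc cdiff X (i + 1))
  <-> kills_weight w (- (i + 1)) f.
Proof.
have [q0 [dq cq qL]] := wc_q0_exists D' i.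
set S := hshm (w := w) (i + 1).
have wd := wc_cP D (- (i + 1)); have wd' := wc_cP D' (- (i + 1)).
split=> [[x [y mE]] A B a b Aw Bw | /(kills_weightP f wd (wc_cP D' (- (i + 1 + 1)))) fK].
  have [a' ->] := wd_lift wd a (lexx _) Aw.
  have [b' b'E] := wc_ext1 (b \oc wc_c D' (- (i + 1))) Bw.
  rewrite -compA [f \oc _]compA -fleP !compA b'E -(compA b').
  rewrite -wc_map_p mE hshmD !hshmM compDl -!compA wc_diff_p compm0 addr0.
  by rewrite dq !compA -b'E -(compA b) cq compm0 !comp0m.
have [|s sE] := fK; first by lia.
have [||x xE] := qL _ (fle (- (i + 1)) - wc_g D' (i + 1) \oc s).
- exact: wd_wle wd.
- by rewrite compBr fleP sE compA wc_gP subrr.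
have [x' x'E] := wc_ext1 x (hsh_wge _ _).
have [x0 x0E] := hshm_full x'.
have pE : (hshm (i + 1) (m (i + 1)) - hshm (i + 1) (cdiff Y i \oc x0)) \oc wc_p D (i + 1) = 0.
  rewrite compBl wc_map_p hshmM dq x0E -!compA -x'E -xE compBr.
  by rewrite [_ \oc (wc_g _ _ \oc _)]compA (tri_comp1 (wc_dist D' _)) comp0m subr0 subrr.
have [y yE] := wc_extd (hsh_wge _ _) pE; have [y0 y0E] := hshm_full y.
exists x0, y0; apply: (@hshm_inj _ _ (i + 1)).
by rewrite hshmD [hshm _ (y0 \oc _)]hshmM y0E -yE [RHS]addrC subrK.
Qed.

Lemma weakly_null_all :
  (exists x y : forall i, mor (X (i + 1)) (Y i), forall i,
     m (i + 1) = cdiff Y i \oc x i + y (i + 1) \oc cdiff X (i + 1))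
  <-> forall n, kills_weight w n f.
Proof.
split=> [[x [y mE]] n|fK].
  have -> : n = - ((- n - 1) + 1) by lia.
  by apply/weakly_null_at; exists (x (- n - 1)), (y (- n - 1 + 1)).
have H i := iffRL (weakly_null_at i) (fK _).
have [x /dep_choice[y mE]] := dep_choice H.
have [y1 y1E] := @int_reindex (fun j => mor (X (j + 1)) (Y j)) y; exists x, y1 => i.
by rewrite y1E mE.
Qed.

End Nullity.

(** * The cone of a morphism *)

Lemma wd_sh (C : triangulated) (w : weight_structure C) m (L M : C) (c : mor L M) :
  weight_decomposition w m c -> weight_decomposition w (m + 1) (fmap sh c).
Proof.
case=> R [b [e [Lw Rw /dist_sh/dist_signs D]]].
rewrite !opprK in D; exists (sh R), (fmap sh b), (- fmap sh e).
by split=> //; [apply: wle_sh | apply: wge_sh].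
Qed.

Section WeightMaps.
Variables (C : triangulated) (w : weight_structure C) (M M' : C).
Variables (D : weight_complex_data w M) (D' : weight_complex_data w M').
Variables (f : mor M M') (fle : forall n, mor (wc_le D n) (wc_le D' n)).
Hypothesis fleP : forall n, wc_c D' n \oc fle n = f \oc wc_c D n.

Lemma fle_g j : fle (- j) \oc wc_g D j = wc_g D' j \oc fle (- (j + 1)).
Proof.
apply: (wd_inj (wc_cP D' (- j)) _ (wc_wle D (- (j + 1)))); first lia.
by rewrite !compA fleP -compA !wc_gP fleP.
Qed.

End WeightMaps.

Section Cone.
Variables (C : triangulated) (w : weight_structure C) (M M' Z : C).
Variables (D : weight_complex_data w M) (D' : weight_complex_data w M').
Variables (f : mor M M') (h : mor M' Z) (k : mor Z (sh M)).
Variable fle : forall n, mor (wc_le D n) (wc_le D' n).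
Hypothesis Df : dist f h k.
Hypothesis fleP : forall n, wc_c D' n \oc fle n = f \oc wc_c D n.
Local Notation X := (wc_complex D).
Local Notation Y := (wc_complex D').
Implicit Types (A B T : C) (i j : int).

(* A cone of w_{<= -(j+1)} M -> w_{<= -j} M', which plays the role of
   w_{<= -j} Z, together with the arrows that the octahedral axiom provides for
   the two factorizations of this morphism. *)
Record cone_step j := ConeStep {
  cs_ob : C;
  cs_h : mor (wc_le D' (- j)) cs_ob;
  cs_k : mor cs_ob (sh (wc_le D (- (j + 1))));
  cs_dist : dist (fle (- j) \oc wc_g D j) cs_h cs_k;
  cs_e : mor (hsh j (X j)) cs_ob;
  cs_v : mor cs_ob (hsh j (Y j));
  cs_ke : cs_k \oc cs_e = wc_q D j;
  cs_ep : cs_e \oc wc_p D j = cs_h \oc fle (- j);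
  cs_vh : cs_v \oc cs_h = wc_p D' j;
  cs_qv : wc_q D' j \oc cs_v = fmap sh (fle (- (j + 1))) \oc cs_k;
  cs_c : mor cs_ob Z;
  cs_ch : cs_c \oc cs_h = h \oc wc_c D' (- j);
  cs_kc : k \oc cs_c = fmap sh (wc_c D (- (j + 1))) \oc cs_k;
  cs_ce : cs_c \oc cs_e = 0;
  cs_Q : C;
  cs_hQ : mor (wc_le D' (- (j + 1))) cs_Q;
  cs_kQ : mor cs_Q (sh (wc_le D (- (j + 1))));
  cs_eQ : mor cs_Q cs_ob;
  cs_distQ : dist (fle (- (j + 1))) cs_hQ cs_kQ;
  cs_eh : cs_eQ \oc cs_hQ = cs_h \oc wc_g D' j;
  cs_keQ : cs_k \oc cs_eQ = cs_kQ;
  cs_vlift : forall A (a : mor A cs_ob), cs_v \oc a = 0 -> exists b, a = cs_eQ \oc b }.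

(** The factorization through $w_{\le -j}M$ yields [e] and a map [s] to the cone of [fle (- j)]; the
    one through $w_{\le -(j+1)}M'$ yields [eQ] and [v]. The arrow to [Z] is taken through [s], so
    that it kills [e]. *)
Lemma cone_step_exists j : exists _ : cone_step j, True.
Proof.
have [E [hE [kE DE]]] := dist_cone (fle (- j) \oc wc_g D j).
have [Q1 [h1 [k1 D1]]] := dist_cone (fle (- j)).
have [Q [hQ [kQ DQ]]] := dist_cone (fle (- (j + 1))).
have DE' := DE; rewrite (fle_g fleP) in DE'.
have [e [s [Des ep ke sh1 ks]]] := dist_octahedral (wc_dist D j) D1 DE.
have [e' [v [Dev eh ke' vh qv]]] := dist_octahedral DQ (wc_dist D' j) DE'.
have [c1 [c1h kc1]] := dist_complete D1 Df (fleP (- j)).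
have cv A (a : mor A E) : v \oc a = 0 -> exists b, a = e' \oc b := tri_lift1 Dev (a := a).
unshelve eexists.
  apply: (@ConeStep j E hE kE DE e v ke ep vh qv (c1 \oc s) _ _ _ Q hQ kQ e' DQ eh ke' cv).
  - by rewrite -compA sh1 c1h.
  - by rewrite compA -kc1 -compA ks compA -fmapM wc_gP.
  - by rewrite -compA (tri_comp1 Des) compm0.
by [].
Qed.

Section Step.
Variables (j : int) (E : cone_step j).

Definition cs_u : mor (cs_ob E) (hsh j (X (j + 1))) := locked (wc_p2 D j \oc cs_k E).

Lemma cs_uE : cs_u = wc_p2 D j \oc cs_k E.
Proof. by rewrite /cs_u -lock. Qed.

Lemma cs_wle : wle w (- j) (cs_ob E).
Proof.
apply: wle_cone (cs_dist E) _ (wc_wle _ _).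
by apply: wle_le (wc_wle _ _); lia.
Qed.

(** The pair of [cs_u] and [cs_v] is thus weakly universal for targets of weight at least $-j$:
    subtracting a multiple of [cs_v] makes the map vanish on [cs_h], and the rest factors through
    [cs_k], hence through [cs_u]. *)
Lemma cs_ext T (a : mor (cs_ob E) T) : wge w (- j) T ->
  exists x y, a = x \oc cs_u + y \oc cs_v E.
Proof.
move=> Tw; have [y yE] := wc_ext1 (a \oc cs_h E) Tw.
have [|x0 x0E] := tri_ext2 (cs_dist E) (b := a - y \oc cs_v E).
  by rewrite compBl -compA cs_vh yE subrr.
have [x xE] := wc_ext2 x0 Tw; exists x, y.
by rewrite cs_uE compA -xE -x0E subrK.
Qed.

Section Kernel.
Variable m : forall i, mor (X i) (Y i).
Hypothesis mP : forall i,
  triangle_morphism (wc_g D i) (wc_p D i) (wc_q D i)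
    (wc_g D' i) (wc_p D' i) (wc_q D' i)
    (fle (- (i + 1))) (fle (- i)) (hshm i (m i)).

Lemma cs_diff_u : hshm j (cdiff X (j + 1)) \oc cs_u = 0.
Proof. by rewrite cs_uE compA wc_diff_p2 comp0m. Qed.

(** Together with [cs_diff_u] this says, up to sign convention, that the pair is a cycle of the cone
    of [m]. *)
Lemma cs_diff_v : hshm j (cdiff Y j) \oc cs_v E = hshm j (m (j + 1)) \oc cs_u.
Proof.
by rewrite cs_uE compA (wc_map_p2 mP) wc_diffE -!compA cs_qv.
Qed.

(** All linear relations between [cs_u] and [cs_v] come from the differential of the cone. *)
Lemma cs_ker T (x : mor (hsh j (X (j + 1))) T) (y : mor (hsh j (Y j)) T) :
  wge w (- j) T -> x \oc cs_u + y \oc cs_v E = 0 ->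
  exists a b, y = a \oc hshm j (cdiff Y j) /\
    x = b \oc hshm j (cdiff X (j + 1)) - a \oc hshm j (m (j + 1)).
Proof.
move=> Tw xy0.
have yp0 : y \oc wc_p D' j = 0.
  have := congr1 (fun z => z \oc cs_h E) xy0.
  rewrite compDl cs_uE -!compA (tri_comp2 (cs_dist E)) cs_vh.
  by rewrite !compm0 add0r comp0m.
have [a yE] := wc_extd Tw yp0.
have [|d dE] := tri_ext3 (cs_dist E)
    (b := (x + a \oc hshm j (m (j + 1))) \oc wc_p2 D j).
  by rewrite -compA -cs_uE compDl -compA -cs_diff_v compA -yE.
(* The first choice [a] leaves the error [d \oc fmap sh (wc_g D' j)]. It is absorbed by [a'], which
   vanishes on the differential of [Y], so [a - a'] still represents [y]. *)
have [a' a'E] := wc_ext2 (d \oc fmap sh (wc_g D' j)) Tw.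
have a'd : a' \oc hshm j (cdiff Y j) = 0.
  by rewrite wc_diffE compA -a'E -compA (tri_comp3 (wc_dist D' j)) compm0.
have [|b bE] := wc_extd2 (D := D) (u := x + (a - a') \oc hshm j (m (j + 1))) Tw.
  rewrite compBl addrA compBl dE (fle_g fleP) fmapM compA a'E.
  by rewrite -!compA (wc_map_p2 mP) subrr.
exists (a - a'), b; split; first by rewrite compBl a'd subr0.
by rewrite -bE addrK.
Qed.

End Kernel.

(** The composite with [k] lifts to $(w_{\le -(j+1)}M)[1]$ and then to the cone; the remaining
    difference comes from [M'], hence from $w_{\le -j}M'$. *)
Lemma cs_cover A (a : mor A Z) : wle w (- j) A -> exists b, a = cs_c E \oc b.
Proof.
move=> Aw.
have [||u uE] := wd_lift (wd_sh (wc_cP D (- (j + 1)))) (n := - j) (k \oc a).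
- by lia.
- by [].
have [|b bE] := tri_lift3 (cs_dist E) (a := u).
  apply: (wd_inj (wd_sh (wc_cP D' (- j))) _ Aw); first lia.
  rewrite compm0 compA -fmapM compA fleP -compA wc_gP fmapM -compA -uE compA.
  by rewrite (tri_comp3 Df) comp0m.
have [|a' a'E] := tri_lift2 Df (a := a - cs_c E \oc b).
  by rewrite compBr compA cs_kc -compA -bE uE subrr.
have [b' b'E] := wd_lift (wc_cP D' (- j)) a' (lexx _) Aw.
exists (b + cs_h E \oc b').
by rewrite compDr compA cs_ch -compA -b'E -a'E addrC subrK.
Qed.

End Step.

(** Both directions compare the identity of the cone with a map through [cs_e] and [cs_h \oc q0],
    both of which [cs_c] kills; [x] and [y] are its two coordinates. *)
Lemma cs_kill i (E : cone_step (i + 1)) (m : mor (X (i + 1)) (Y (i + 1))) :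
  hshm (i + 1) m = cs_v E \oc cs_e E ->
  kills_weight w (- (i + 1)) (idm Z) <->
  exists x y, cs_u E = hshm (i + 1) (cdiff X (i + 1)) \oc x /\
    cs_v E = hshm (i + 1) m \oc x + hshm (i + 1) (cdiff Y i) \oc y.
Proof.
move=> mE; have [q0 [dq cq qL]] := wc_q0_exists D' i; split=> [ZK | [x [y [uE vE]]]].
  have Ew := cs_wle E.
  have [L [c cD]] := weight_decomposition_exists w (- (i + 1)) Z.
  have [L' [c' c'D]] := weight_decomposition_exists w (- (i + 1) - 1) Z.
  have [|s sE] := iffLR (kills_weightP _ cD c'D _) ZK; first by rewrite subrK.
  rewrite comp1m in sE.
  have [r rE] := wd_lift cD (cs_c E) (lexx _) Ew.
  have Lw := wd_wle c'D.
  have [|l lE] := cs_cover E c'; first by apply: wle_le Lw; lia.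
  set phi := idm _ - l \oc (s \oc r).
  have cphi : cs_c E \oc phi = 0.
    by rewrite compBr compm1 compA -lE compA -sE -rE subrr.
  have phi_id T (a : mor (cs_ob E) T) : wge w (- (i + 1)) T -> a \oc phi = a.
    move=> Tw; rewrite compBr compm1 compA.
    by rewrite (w_orthogonal (a \oc l) _ Lw Tw) ?comp0m ?subr0 //; lia.
  have [|x xE] := tri_lift3 (wc_dist D (i + 1)) (a := cs_k E \oc phi).
    apply: (wd_inj (wd_sh (wc_cP D (- (i + 1)))) _ Ew); first lia.
    by rewrite compm0 !compA -fmapM wc_gP -cs_kc -compA cphi compm0.
  have [|b bE] := tri_lift2 (cs_dist E) (a := phi - cs_e E \oc x).
    by rewrite compBr xE compA cs_ke subrr.
  have [|a aE] := tri_lift1 Df (a := wc_c D' (- (i + 1)) \oc b).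
    by rewrite compA -(cs_ch E) -compA -bE compBr cphi compA cs_ce comp0m subrr.
  have [a' a'E] := wd_lift (wc_cP D (- (i + 1))) a (lexx _) Ew.
  have [||y yE] := qL _ (b - fle (- (i + 1)) \oc a') => //.
    by rewrite compBr aE a'E !compA fleP subrr.
  have phiE : phi = cs_e E \oc (x + wc_p D (i + 1) \oc a') + cs_h E \oc (q0 \oc y).
    rewrite -yE [cs_e E \oc (_ + _)]compDr [cs_e E \oc (_ \oc _)]compA cs_ep.
    rewrite compBr -bE !compA addrACA subrr addr0.
    by rewrite [RHS]addrC subrK.
  exists (x + wc_p D (i + 1) \oc a'), y; split.
    rewrite -(phi_id _ (cs_u E)); last exact: hsh_wge.
    rewrite phiE compDr cs_uE wc_diffE -(cs_ke E) -!compA.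
    rewrite [cs_k E \oc (cs_h E \oc _)]compA (tri_comp2 (cs_dist E)) comp0m.
    by rewrite compm0 addr0.
  rewrite -(phi_id _ (cs_v E)); last exact: hsh_wge.
  by rewrite phiE compDr mE dq -!compA [cs_v E \oc (cs_h E \oc _)]compA cs_vh.
move=> A B a b Aw Bw; have [a' ->] := cs_cover E a Aw.
rewrite compm1 compA; suff -> : b \oc cs_c E = 0 by rewrite comp0m.
(* Here [phi] does not change [b \oc cs_c E], while [cs_u] and [cs_v] both kill it. *)
set phi := idm _ - cs_e E \oc x - cs_h E \oc (q0 \oc y).
have -> : b \oc cs_c E = b \oc cs_c E \oc phi.
  rewrite !compBr compm1 [_ \oc (cs_e E \oc x)]compA -(compA b) cs_ce compm0 comp0m subr0.
  rewrite [_ \oc (cs_h E \oc _)]compA -(compA b) cs_ch -!compA.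
  by rewrite [wc_c _ _ \oc _]compA cq comp0m !compm0 subr0.
have vphi : cs_v E \oc phi = 0.
  rewrite !compBr compm1 !compA -mE cs_vh -dq {1}vE.
  by rewrite [X in X - _ - _]addrC addrK subrr.
(* So [phi] factors through [cs_eQ]. There [b \oc cs_c E] vanishes on [cs_hQ] by orthogonality, so
   it factors through [cs_kQ] and [wc_p2], and the result contains [cs_u] applied to [phi], which is
   0. *)
have [c cE] := cs_vlift vphi.
have [|d dE] := tri_ext2 (cs_distQ E) (b := b \oc cs_c E \oc cs_eQ E).
  by rewrite -compA cs_eh; apply: w_orthogonal (wc_wle _ _) Bw; lia.
have [d' d'E] := wc_ext2 d Bw.
rewrite cE compA dE d'E -!compA -cs_keQ -!compA -cE.
rewrite [wc_p2 _ _ \oc _]compA -cs_uE !compBr compm1 cs_uE.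
rewrite [_ \oc (cs_h E \oc _)]compA -[_ \oc cs_h E]compA (tri_comp2 (cs_dist E)).
rewrite [_ \oc (cs_e E \oc _)]compA -[_ \oc cs_e E]compA cs_ke -wc_diffE -uE cs_uE.
by rewrite compm0 comp0m compm0 subr0; apply: subrr.
Qed.

End Cone.

(** * Weak homotopy and the isomorphism criterion *)

Lemma int_shift_case (P : int -> Prop) : (forall i, P (i + 1)) -> forall j, P j.
Proof. by move=> H j; rewrite -(subrK 1 j). Qed.

Lemma is_iso_lr (C : preadditive) (X Y : C) (f : mor X Y) (l r : mor Y X) :
  l \oc f = idm X -> f \oc r = idm Y -> is_iso f.
Proof.
move=> lf fr; exists l; split=> //.
by rewrite -[l]compm1 -fr [l \oc _]compA lf comp1m.
Qed.

Lemma quotient_isoP (C : preadditive) (I : cat_ideal C) (X Y : C) (f : mor X Y) :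
  @is_iso (quotient_category I) X Y (cls I f) <->
  exists g : mor Y X, imem I (g \oc f - idm X) /\ imem I (f \oc g - idm Y).
Proof.
split=> [[g' [gf fg]] | [g [gf fg]]].
  have [g gE] := cls_surj g'; rewrite -gE /= in gf fg; exists g; split; apply/cls_eq.
    by rewrite -qcomp_cls gf.
  by rewrite -qcomp_cls fg.
by exists (cls I g); split; rewrite /= qcomp_cls; apply/cls_eq.
Qed.

Section Complexes.
Variable B : preadditive.
Implicit Types X Y Z : complex B.

(** The two sides are [f d] and [d f]. *)
Lemma weakly_null_diff X Y (f : chain_map X Y) (x y : forall i, mor (X (i + 1)) (Y i)) :
  (forall i, f (i + 1) = cdiff Y i \oc x i + y (i + 1) \oc cdiff X (i + 1)) ->
  forall j, cdiff Y j \oc (x j \oc cdiff X j) = cdiff Y j \oc (y j \oc cdiff X j).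
Proof.
move=> fE; apply: int_shift_case => i; have := cmapP f (i + 1).
rewrite !fE compDl compDr -!compA cdiffK !compm0 addr0.
by rewrite [cdiff _ _ \oc (cdiff _ _ \oc _)]compA cdiffK comp0m add0r.
Qed.

(* [h = x' y d + y' d x], for [g = d x' + y' d] and [f = d x + y d]. *)
Lemma weakly_nullM X Y Z (g : chain_map Y Z) (f : chain_map X Y) :
  weakly_null g -> weakly_null f -> null_homotopic (cmM g f).
Proof.
move=> [x' [y' gE]] [x [y fE]].
have dg := weakly_null_diff gE; have df := weakly_null_diff fE.
exists (fun i => x' i \oc (y (i + 1) \oc cdiff X (i + 1))
               + y' i \oc (cdiff Y i \oc x i)) => i /=.
rewrite gE fE !compDl !compDr -!compA cdiffK !compm0 add0r.
rewrite ![cdiff Y (i + 1) \oc (cdiff Y i \oc _)]compA cdiffK comp0m compm0 add0r.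
rewrite [cdiff Z i \oc (x' i \oc (cdiff Y i \oc _))](_ : _ =
    cdiff Z i \oc (y' i \oc (cdiff Y i \oc x i))); last first.
  by rewrite [x' i \oc _]compA [y' i \oc _]compA [LHS]compA [RHS]compA dg.
by rewrite df; congr (_ + _); apply: addrC.
Qed.

(** If $e=1+u$ with $u$ weakly null, then $u^2$ is null homotopic, so $1-u$ inverts $e$ up to
    homotopy; this corrects a weak inverse to a left and a right inverse. *)
Lemma Kweak_conservative X Y (f : chain_map X Y) :
  @is_iso (Kweak B) X Y (cls (weakly_null_ideal B) f) ->
  @is_iso (Khtpy B) X Y (cls (null_homotopic_ideal B) f).
Proof.
move=> /(@quotient_isoP (Ch B))[g [gf fg]].
have half A (e : @mor (Ch B) A A) : weakly_null (e - idm A) ->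
    cls (null_homotopic_ideal B) ((idm A - (e - idm A)) \oc e) = cls _ (idm A) /\
    cls (null_homotopic_ideal B) (e \oc (idm A - (e - idm A))) = cls _ (idm A).
  have eE : e = (e - idm A) + idm A by rewrite subrK.
  move: (e - _) eE => u -> uN.
  have uuN : null_homotopic (- (u \oc u) : chain_map A A).
    have := imemB (imem0 (null_homotopic_ideal B) A A) (weakly_nullM uN uN).
    by rewrite sub0r.
  have cancel (V : zmodType) (a b c : V) : a + b - (c + a) - b = - c.
    by rewrite opprD [- c - a]addrC [a + b]addrC addrA addrK addrAC subrr add0r.
  split; apply/cls_eq; move: uuN; congr null_homotopic.
    by rewrite compBl comp1m compDr compm1 cancel.
  by rewrite compBr compm1 compDl comp1m cancel.
pose q U V (u : @mor (Ch B) U V) := cls (null_homotopic_ideal B) u.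
pose F : @mor (Ch B) X Y := f.
have := @is_iso_lr (Khtpy B) X Y (q _ _ F)
  (q _ _ ((idm (X : Ch B) - (g \oc F - idm (X : Ch B))) \oc g))
  (q _ _ (g \oc (idm (Y : Ch B) - (F \oc g - idm (Y : Ch B))))).
apply; rewrite /= /q qcomp_cls.
  by rewrite -compA; apply: (half _ _ gf).1.
by rewrite compA; apply: (half _ _ fg).2.
Qed.

Section WeakInverse.
Variables (X Y : complex B) (m : chain_map X Y).
Variables b b' : forall i, mor (Y i) (X i).
Variables al A : forall i, mor (X (i + 1)) (X i).
Variables ep Ga : forall i, mor (Y (i + 1)) (Y i).
Hypothesis db : forall i, cdiff X i \oc b i = b' (i + 1) \oc cdiff Y i.
Hypothesis b'm : forall i, idm (X (i + 1)) =
  cdiff X i \oc al i + b' (i + 1) \oc m (i + 1) + A (i + 1) \oc cdiff X (i + 1).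
Hypothesis mb : forall i, idm (Y (i + 1)) =
  m (i + 1) \oc b (i + 1) + cdiff Y i \oc ep i + Ga (i + 1) \oc cdiff Y (i + 1).

(** Neither [b] nor [b'] need be a chain map. The family [n] differs from [b'] by a map through the
    differential of [Y] and, by [nE], from [b] by one through the differential of [X]; so [db] makes
    it a chain map. *)
Let n i : mor (Y i) (X i) :=
  b' i + (A i \oc b' (i + 1) - b' i \oc Ga i) \oc cdiff Y i.

Let nE i : n (i + 1) =
  b (i + 1) + cdiff X i \oc (b i \oc ep i - al i \oc b (i + 1)).
Proof.
have E1 : b' (i + 1) - b' (i + 1) \oc (Ga (i + 1) \oc cdiff Y (i + 1)) =
    b' (i + 1) \oc (m (i + 1) \oc b (i + 1)) + cdiff X i \oc (b i \oc ep i).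
  rewrite [cdiff X i \oc _]compA db -[_ \oc ep i]compA -!compDr.
  by apply/eqP; rewrite subr_eq -compDr -mb compm1.
have E2 : b' (i + 1) \oc (m (i + 1) \oc b (i + 1)) +
    A (i + 1) \oc (cdiff X (i + 1) \oc b (i + 1)) =
    b (i + 1) - cdiff X i \oc (al i \oc b (i + 1)).
  apply: (addrI (cdiff X i \oc (al i \oc b (i + 1)))).
  by rewrite [RHS]addrC subrK addrA !compA -!compDl -b'm comp1m.
rewrite /n compBl -!compA -db addrCA E1 addrA [A _ \oc _ + _]addrC E2.
by rewrite compBr addrA addrAC.
Qed.

Let n_chain i : n (i + 1) \oc cdiff Y i = cdiff X i \oc n i.
Proof.
transitivity (b' (i + 1) \oc cdiff Y i).
  by rewrite /n compDl -compA cdiffK compm0 addr0.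
rewrite -db; elim/int_shift_case: i => i.
by rewrite nE compDr compA cdiffK comp0m addr0.
Qed.

Lemma weak_inverse_iso : @is_iso (Kweak B) X Y (cls (weakly_null_ideal B) m).
Proof.
apply/(@quotient_isoP (Ch B)).
exists (ChainMap n_chain : @mor (Ch B) Y X); split.
  exists (fun i => - al i), (fun i =>
    (A i \oc b' (i + 1) - b' i \oc Ga i) \oc m (i + 1) - A i) => i /=.
  rewrite {1}/n (b'm i) compDl -compA -cmapP compA compBl compmN.
  rewrite !opprD [- (cdiff X i \oc al i) - b' _ \oc _]addrC -[- (b' _ \oc _) - _ - _]addrA.
  rewrite addrACA subrr.
  by rewrite add0r addrCA.
exists (fun i => m i \oc (b i \oc ep i - al i \oc b (i + 1)) - ep i),
  (fun i => - Ga i) => i /=.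
rewrite nE (mb i) compDr compA cmapP -compA compBr compNm.
rewrite !opprD -[- (m _ \oc _) - _ - _]addrA addrACA subrr add0r.
by rewrite [in RHS]compBr addrA.
Qed.

End WeakInverse.
End Complexes.

Section IsoCriterion.
Variables (C : triangulated) (w : weight_structure C) (M M' Z : C).
Variables (D : weight_complex_data w M) (D' : weight_complex_data w M').
Variables (f : mor M M') (h : mor M' Z) (k : mor Z (sh M)).
Hypothesis Df : dist f h k.
Local Notation X := (wc_complex D).
Local Notation Y := (wc_complex D').

(* The difference of two chain maps over [g] is one over the zero morphism,
   which kills all weights. *)
Lemma weight_complex_map_unique (g : mor M M') (m1 m2 : chain_map X Y) :
  weight_complex_map g m1 -> weight_complex_map g m2 ->
  cls (weakly_null_ideal (Hw w)) m1 = cls (weakly_null_ideal (Hw w)) m2.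
Proof.
move=> [e1 [e1P m1P]] [e2 [e2P m2P]]; apply/cls_eq.
apply: (iffRL (weakly_null_all (f := g - g) (fle := fun n => e1 n - e2 n)
  (m := fun i => m1 i - m2 i) _ _)).
- by move=> n; rewrite compBr e1P e2P compBl.
- move=> i; rewrite hshmB; split.
  + by rewrite compBl compBr !(fle_g e1P, fle_g e2P).
  + by rewrite compBl compBr (wc_map_p m1P) (wc_map_p m2P).
  by rewrite fmapB compBl compBr (wc_map_q m1P) (wc_map_q m2P).
by move=> n A B a b _ _; rewrite subrr compm0 comp0m.
Qed.

(** By [cs_kill] the claim is that the universal cycles are boundaries in all degrees exactly when
    the map has a weak inverse. *)
Lemma weight_complex_iso (m : chain_map X Y) : weight_complex_map f m ->
  @is_iso (Kweak (Hw w)) X Y (cls (weakly_null_ideal (Hw w)) m) <->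
  forall n, kills_weight w n (idm Z).
Proof.
move=> mf; have [fle [fleP _]] := mf.
(* The map may be replaced by any other one over [f]; the components [v e] are those to which
   [cs_kill] applies. *)
pose E j := projT1 (cid (cone_step_exists Df fleP j)).
have [n nE] := dep_choice (fun j => hshm_full (cs_v (E j) \oc cs_e (E j))).
have nP i : triangle_morphism (wc_g D i) (wc_p D i) (wc_q D i)
    (wc_g D' i) (wc_p D' i) (wc_q D' i)
    (fle (- (i + 1))) (fle (- i)) (hshm i (n i)).
  rewrite nE; split; first exact: fle_g fleP i.
    by rewrite -compA cs_ep compA cs_vh.
  by rewrite compA cs_qv -compA cs_ke.
pose N : chain_map X Y := ChainMap (wc_map_chain nP).
have Nf : weight_complex_map f N by exists fle; split.
rewrite (weight_complex_map_unique mf Nf) {m mf}.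
have killP i := cs_kill Df fleP (E := E (i + 1)) (nE (i + 1)).
split=> [/(@quotient_isoP (Ch (Hw w)))[g [[x [y gN]] [x' [y' Ng]]]] j | ZK].
  have -> : j = - (- j - 1 + 1) by lia.
  move: (- j - 1) => i {j}; apply/killP.
  pose u := cs_u (E (i + 1)); pose v := cs_v (E (i + 1)).
  have du : hshm (i + 1) (cdiff X (i + 1 + 1)) \oc u = 0 by apply: cs_diff_u.
  have dv : hshm (i + 1) (cdiff Y (i + 1)) \oc v = hshm (i + 1) (n (i + 1 + 1)) \oc u.
    exact: cs_diff_v nP.
  have gnE : u = hshm (i + 1) (g (i + 1 + 1) \oc n (i + 1 + 1)) \oc u
      - hshm (i + 1) (cdiff X (i + 1) \oc x (i + 1)) \oc u.
    have := congr1 (@hshm C w (i + 1) _ _) (gN (i + 1)); rewrite /= !(hshmB, hshmD) hshm1.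
    move=> /(congr1 (fun z => z \oc u)); rewrite compBl comp1m compDl.
    rewrite [hshm _ (y _ \oc _)]hshmM -[hshm _ (y _) \oc _ \oc u]compA du compm0 addr0.
    by move=> <-; rewrite opprB [RHS]addrC subrK.
  have ngE p : hshm (i + 1) (cdiff Y (i + 1)) \oc p = 0 ->
      p = hshm (i + 1) (n (i + 1) \oc g (i + 1)) \oc p
          - hshm (i + 1) (cdiff Y i \oc x' i) \oc p
        :> mor (cs_ob (E (i + 1))) _.
    have := congr1 (@hshm C w (i + 1) _ _) (Ng i); rewrite /= !(hshmB, hshmD) hshm1.
    move=> /(congr1 (fun z => z \oc p)); rewrite compBl comp1m compDl => + dp.
    rewrite [hshm _ (y' _ \oc _)]hshmM -[hshm _ (y' _) \oc _ \oc p]compA dp compm0 addr0.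
    by move=> <-; rewrite opprB [RHS]addrC subrK.
  (* A weak inverse gives [r] with [d r = u]. The defect [p] of the second equation is a cycle, and
     [ngE] corrects [r] by [g p]. *)
  pose r := hshm (i + 1) (g (i + 1)) \oc v - hshm (i + 1) (x (i + 1)) \oc u.
  have uE : u = hshm (i + 1) (cdiff X (i + 1)) \oc r.
    rewrite compBr !compA -!hshmM -(cmapP g) {1}gnE; congr (_ - _).
    by rewrite !hshmM -!compA dv.
  pose p := v - hshm (i + 1) (n (i + 1)) \oc r.
  have dp : hshm (i + 1) (cdiff Y (i + 1)) \oc p = 0.
    rewrite compBr dv compA -hshmM -(wc_map_chain nP) hshmM -compA -uE.
    exact: subrr.
  exists (r + hshm (i + 1) (g (i + 1)) \oc p), (- (hshm (i + 1) (x' i) \oc p)); split.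
    rewrite compDr -uE compA -[_ \oc hshm (i + 1) (g _)]hshmM -(cmapP g) hshmM -compA dp.
    by rewrite compm0 addr0.
  rewrite compDr compmN !compA -!hshmM -addrA -(ngE _ dp) /p [RHS]addrC.
  by rewrite subrK.
have H i : exists (b : mor (Y (i + 1)) (X (i + 1)))
    (al : mor (X (i + 1 + 1)) (X (i + 1))) (Ga : mor (Y (i + 1 + 1)) (Y (i + 1)))
    (ep : mor (Y (i + 1)) (Y i)) (b1 : mor (Y (i + 1 + 1)) (X (i + 1 + 1)))
    (A1 : mor (X (i + 1 + 1 + 1)) (X (i + 1 + 1))),
    [/\ cdiff X (i + 1) \oc b = b1 \oc cdiff Y (i + 1),
        idm (X (i + 1 + 1)) = cdiff X (i + 1) \oc al + b1 \oc n (i + 1 + 1)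
                             + A1 \oc cdiff X (i + 1 + 1)
      & idm (Y (i + 1)) = n (i + 1) \oc b + cdiff Y i \oc ep + Ga \oc cdiff Y (i + 1)].
  (* Expanding [x] and [y] in [u] and [v] turns the boundary equations into linear relations, from
     which [cs_ker] reads off identities between morphisms of the heart. *)
  have [x [y [uE vE]]] := iffLR (killP i) (ZK _).
  have [al0 [b0 xE]] := cs_ext (E := E (i + 1)) x (hsh_wge _ _).
  have [ga0 [ep0 yE]] := cs_ext (E := E (i + 1)) y (hsh_wge _ _).
  have [al alE] := hshm_full al0; have [b bE] := hshm_full b0.
  have [ga gaE] := hshm_full ga0; have [ep epE] := hshm_full ep0.
  have K := cs_ker fleP (E := E (i + 1)) nP (hsh_wge (i + 1) _).
  have [|a1 [c1 [E1 E1']]] := K _ (hshm (i + 1) (idm _ - cdiff X (i + 1) \oc al))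
      (hshm (i + 1) (- (cdiff X (i + 1) \oc b))).
    rewrite hshmB hshm1 hshmN !hshmM compBl comp1m compNm alE bE -!compA.
    by apply/eqP; rewrite subr_eq add0r subr_eq {1}uE xE compDr [X in _ == X]addrC.
  have [|a2 [c2 [E2 _]]] := K _ (hshm (i + 1) (- (n (i + 1) \oc al + cdiff Y i \oc ga)))
      (hshm (i + 1) (idm _ - n (i + 1) \oc b - cdiff Y i \oc ep)).
    rewrite hshmN hshmD !hshmB hshm1 !hshmM !(compNm, compBl, compDl) comp1m.
    rewrite alE bE gaE epE -!compA [LHS]addrC; apply/eqP.
    rewrite subr_eq0 !subr_eq {1}vE xE yE !compDr addrAC.
    by rewrite addrA [X in _ == X]addrAC addrAC.
  have [a1' a1E] := hshm_full a1; have [c1' c1E] := hshm_full c1.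
  have [a2' a2E] := hshm_full a2.
  exists b, al, a2', ep, (- a1'), c1'; split; apply: (@hshm_inj _ _ (i + 1)).
  - rewrite hshmM [RHS]hshmM hshmN compNm a1E -E1 hshmN opprK.
    by rewrite hshmM.
  - rewrite !hshmD [hshm _ (- _ \oc _)]hshmM hshmN compNm a1E.
    rewrite [hshm _ (c1' \oc _)]hshmM c1E.
    rewrite -[_ - a1 \oc _ + _]addrA [- (a1 \oc _) + _]addrC -E1' hshmB.
    by rewrite [RHS]addrC subrK.
  rewrite !hshmD [hshm _ (a2' \oc _)]hshmM a2E -E2 !hshmB.
  by rewrite -[X in _ = _ + X]addrA -opprD [RHS]addrC subrK.
have [b0 /dep_choice[al0 /dep_choice[Ga0 /dep_choice[ep /dep_choice[b1 /dep_choice[A1]]]]]] :=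
  dep_choice H.
have [b bE] := @int_reindex (fun j => mor (Y j) (X j)) b0.
have [al alE] := @int_reindex (fun j => mor (X (j + 1)) (X j)) al0.
have [Ga GaE] := @int_reindex (fun j => mor (Y (j + 1)) (Y j)) Ga0.
(* [b1] and [A1] live in degrees [i + 1 + 1], so each is reindexed twice. *)
have [b2 b2E] := @int_reindex (fun j => mor (Y (j + 1)) (X (j + 1))) b1.
have [b' b'E] := @int_reindex (fun j => mor (Y j) (X j)) b2.
have [A2 A2E] := @int_reindex (fun j => mor (X (j + 1 + 1)) (X (j + 1))) A1.
have [A AE] := @int_reindex (fun j => mor (X (j + 1)) (X j)) A2.
move=> {}H; apply: (@weak_inverse_iso _ _ _ N b b' al A ep Ga).
- apply: int_shift_case => i; rewrite b'E b2E bE; by case: (H i).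
- apply: int_shift_case => i; rewrite b'E b2E alE AE A2E; by case: (H i).
- move=> i; rewrite bE GaE; by case: (H i).
Qed.

End IsoCriterion.

(** * Weight complexes from given decompositions *)

Lemma heart_hsh (C : triangulated) (w : weight_structure C) j (P : C) :
  wle w (- j) P -> wge w (- j) P -> exists A : Hw w, isomorphic P (hsh j A).
Proof.
move=> [Y [Yle PY]] /(wge_iso PY)/(shift_class_reflect (@wge0_retract _ w)) Yge.
have YH : w_eq0 w Y.
  split; first exact/(shift_class0 (@wge0_retract _ w)).
  exact/(shift_class0 (@wle0_retract _ w)).
by exists (exist _ Y YH).
Qed.

Section Data.
Variables (C : triangulated) (w : weight_structure C) (M : C).
Implicit Types (i n : int).

Section Step.
Variables (i : int) (L0 L1 : C) (c0 : mor L0 M) (c1 : mor L1 M) (g : mor L0 L1).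
Hypothesis cD0 : weight_decomposition w (- (i + 1)) c0.
Hypothesis cD1 : weight_decomposition w (- i) c1.
Hypothesis cg : c1 \oc g = c0.

(** The cone of [g] has weight at most $-i$ by extension. It has weight at least $-i$ because a map
    into it from lower weight lifts to [L1], and there factors through [g]. *)
Lemma wc_step_exists : exists (A : Hw w) (p : mor L1 (hsh i A)) (q : mor (hsh i A) (sh L0)),
  dist g p q.
Proof.
have [P [p [q D]]] := dist_cone g.
have Pge : wge w (- i) P.
  rewrite -(subrK 1 (- i)); apply: wgeP => A a Aw.
  have [|b bE] := tri_lift2 D (a := a).
    apply: (wd_inj (wd_sh cD0) _ Aw); first lia.
    by rewrite compm0 -cg fmapM -compA [fmap sh g \oc _]compA (tri_comp3 D) comp0m compm0.
  have [||d dE] := wd_lift cD0 (n := - i - 1) (c1 \oc b) => //; first lia.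
  rewrite bE (_ : b = g \oc d) ?compA ?(tri_comp1 D) ?comp0m //.
  apply: (wd_inj cD1 _ Aw); first lia.
  by rewrite dE compA cg.
have Ple : wle w (- i) P.
  apply: wle_cone D _ (wd_wle cD1).
  by have := wd_wle cD0; apply: wle_le; lia.
have [A [u uI]] := heart_hsh Ple Pge; have [v [vu uv]] := uI.
exists A, (u \oc p), (q \oc v); apply: dist_iso (iso1 _) (iso1 _) uI _ _ _ D.
- by rewrite comp1m compm1.
- by rewrite compm1.
- by rewrite fmap1 comp1m -compA vu compm1.
Qed.

End Step.

(** Decompositions can be prescribed in all weights at once. The equality of dependent pairs lets
    [wc_zero] detect where the prescription is constant. *)
Lemma weight_complex_data_exists (F : int -> {L : C & mor L M}) :
  (forall n, weight_decomposition w n (projT2 (F n))) ->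
  exists D : weight_complex_data w M,
    forall n, existT (fun L => mor L M) (wc_le D n) (wc_c D n) = F n.
Proof.
move=> FD; pose le n := projT1 (F n); pose c n : mor (le n) M := projT2 (F n).
have gX i : exists g : mor (le (- (i + 1))) (le (- i)), c (- i) \oc g = c (- (i + 1)).
  have [||g gE] := wd_lift (FD (- i)) (n := - (i + 1)) (c (- (i + 1))).
  - lia.
  - exact: wd_wle (FD _).
  by exists g.
have [g gP] := dep_choice gX.
have tX i := wc_step_exists (FD (- (i + 1))) (FD (- i)) (gP i).
have [X /dep_choice[p /dep_choice[q D]]] := dep_choice tX.
have dX i : exists d : mor (X i) (X (i + 1)),
    hshm i d = hsh_succ i (X (i + 1)) \oc (fmap sh (p (i + 1)) \oc q i).
  exact: hshm_full.
have [d dE] := dep_choice dX.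
have dd i : d (i + 1) \oc d i = 0.
  apply: (@hshm_inj _ _ i); rewrite hshm0 hshmM dE compA hsh_succ_nat dE.
  rewrite fmapM -!compA [fmap sh (_ \oc q _) \oc _]compA -fmapM.
  by rewrite -compA (tri_comp2 (D (i + 1))) compm0 fmap0 comp0m !compm0.
exists (@WeightComplexData C w M le c FD (Complex dd) g gP p q D dE) => n.
by rewrite /= /le /c; case: (F n).
Qed.

(** By uniqueness, [wc_g] is the identification of the two equal terms, and the cone of an
    isomorphism vanishes. *)
Lemma wc_zero (D : weight_complex_data w M) i :
  existT (fun L => mor L M) (wc_le D (- (i + 1))) (wc_c D (- (i + 1)))
  = existT _ (wc_le D (- i)) (wc_c D (- i)) ->
  is_zero (wc_complex D i).
Proof.
have aux (u v : {L : C & mor L M}) : u = v ->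
    exists s : mor (projT1 u) (projT1 v), is_iso s /\ projT2 v \oc s = projT2 u.
  by move=> ->; exists (idm _); split; [apply: iso1 | rewrite compm1].
move=> /aux[s [sI /= cs]].
have gs : wc_g D i = s.
  apply: (wd_inj (wc_cP D (- i)) _ (wc_wle D (- (i + 1)))); first lia.
  by rewrite cs wc_gP.
have T := wc_dist D i; rewrite gs in T.
have p0 : wc_p D i = 0.
  by apply: (iso_surj sI); rewrite comp0m (tri_comp1 T).
apply/is_zeroP/(@hshm_inj _ _ i); rewrite hshm1 hshm0.
have [|b ->] := tri_lift2 T (a := idm _).
  rewrite compm1; apply: (iso_inj (fmap_iso sh sI)).
  by rewrite compm0 (tri_comp3 T).
by rewrite p0 comp0m.
Qed.

End Data.

(** * Functoriality and independence of the choices *)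

Section Functoriality.
Variables (C : triangulated) (w : weight_structure C).

Lemma weight_complex_map_exists (M M' : C) (D : weight_complex_data w M)
    (D' : weight_complex_data w M') (f : mor M M') :
  exists m : chain_map (wc_complex D) (wc_complex D'), weight_complex_map f m.
Proof.
have eX n : exists e : mor (wc_le D n) (wc_le D' n), wc_c D' n \oc e = f \oc wc_c D n.
  have [e eE] := wd_lift (wc_cP D' n) (f \oc wc_c D n) (lexx _) (wc_wle D n).
  by exists e.
have [e eP] := dep_choice eX.
have mX i : exists m : mor (wc_complex D i) (wc_complex D' i),
    triangle_morphism (wc_g D i) (wc_p D i) (wc_q D i)
      (wc_g D' i) (wc_p D' i) (wc_q D' i) (e (- (i + 1))) (e (- i)) (hshm i m).
  have [u [up uq]] := dist_complete (wc_dist D i) (wc_dist D' i) (fle_g eP i).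
  by have [m mE] := hshm_full u; exists m; rewrite mE; split=> //; apply: fle_g.
have [m mP] := dep_choice mX.
by exists (ChainMap (wc_map_chain mP)), e.
Qed.

Lemma weight_complex_map1 (M : C) (D : weight_complex_data w M) :
  weight_complex_map (D := D) (D' := D) (idm M) (cm1 (wc_complex D)).
Proof.
exists (fun n => idm (wc_le D n)); split=> [n | i]; first by rewrite comp1m compm1.
by split; rewrite ?[heart_hom _]/= ?fmap1 ?comp1m ?compm1.
Qed.

Lemma weight_complex_mapM (M M' M2 : C) (D : weight_complex_data w M)
    (D' : weight_complex_data w M') (D2 : weight_complex_data w M2)
    (g : mor M' M2) (f : mor M M') (n : chain_map (wc_complex D') (wc_complex D2))
    (m : chain_map (wc_complex D) (wc_complex D')) :
  weight_complex_map g n -> weight_complex_map f m ->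
  weight_complex_map (D := D) (D' := D2) (g \oc f) (cmM n m).
Proof.
move=> [e' [e'P nP]] [e [eP mP]]; exists (fun n => e' n \oc e n).
split=> [j | i]; first by rewrite compA e'P -compA eP compA.
rewrite -/(hshm i (cmM n m i)) hshmM; split.
- by rewrite -compA (fle_g eP) [LHS]compA (fle_g e'P) -compA.
- by rewrite -compA (wc_map_p mP) [LHS]compA (wc_map_p nP) -compA.
- by rewrite fmapM -compA (wc_map_q mP) [LHS]compA (wc_map_q nP) -compA.
Qed.

(** Maps over the identity are inverse up to weak homotopy by uniqueness. Conservativity upgrades
    this to a homotopy equivalence, as the classes [Kst_le] and [Kst_ge] require. *)
Lemma weight_complex_independent (M : C) (D D' : weight_complex_data w M) :
  @isomorphic (Khtpy (Hw w)) (wc_complex D) (wc_complex D').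
Proof.
have [m mP] := weight_complex_map_exists D D' (idm M).
have [n nP] := weight_complex_map_exists D' D (idm M).
exists (cls (null_homotopic_ideal (Hw w)) m); apply: Kweak_conservative.
apply/(@quotient_isoP (Ch (Hw w))).
have nm := weight_complex_mapM nP mP; have mn := weight_complex_mapM mP nP.
rewrite comp1m in nm mn.
by exists n; split; apply/cls_eq; apply: weight_complex_map_unique;
  [exact: nm | exact: weight_complex_map1 | exact: mn | exact: weight_complex_map1].
Qed.

Lemma kills_all_weak_null (M : C) (D : weight_complex_data w M) :
  weakly_null (cm1 (wc_complex D)) <-> forall n, kills_weight w n (idm M).
Proof.
have [e [eP mP]] := weight_complex_map1 D.
exact: (weakly_null_all eP mP).
Qed.

Lemma null_at_kills (M : C) (D : weight_complex_data w M) i :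
  (exists (x : mor (wc_complex D (i + 1)) (wc_complex D i))
          (y : mor (wc_complex D (i + 1 + 1)) (wc_complex D (i + 1))),
     idm (wc_complex D (i + 1)) =
       cdiff (wc_complex D) i \oc x + y \oc cdiff (wc_complex D) (i + 1))
  <-> kills_weight w (- (i + 1)) (idm M).
Proof.
have [e [eP mP]] := weight_complex_map1 D.
exact: (weakly_null_at eP mP).
Qed.

Lemma degenerateP (t : weight_complex_functor w) (M : C) :
  degenerate t M <-> forall n, kills_weight w n (idm M).
Proof.
rewrite -(kills_all_weak_null (wcf_data t M)) /degenerate is_zeroP.
have -> : (0 : @mor (Kweak (Hw w)) (t M) (t M)) = cls (weakly_null_ideal (Hw w)) 0.
  by apply: (addrI (cls _ 0)); rewrite -clsD !addr0.
split=> [/cls_eq | H]; first by rewrite subr0.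
by apply/cls_eq; rewrite subr0.
Qed.

(** As [L] has all weights, [a] is a $k$-weight decomposition for every $k\ge n$; a tower constant
    there has zero terms in degrees below $-n$. *)
Lemma Kst_le_extension (M : C) (D : weight_complex_data w M) n L A :
  left_degenerate w L -> wle w n A -> extension_of M L A -> Kst_le n (wc_complex D).
Proof.
move=> Ll An [a [b [c T]]].
pose F k := if (n <= k)%R then existT (fun L => mor L M) A a
            else existT _ (wc_le D k) (wc_c D k).
have [D' FE] : exists D' : weight_complex_data w M,
    forall k, existT (fun L => mor L M) (wc_le D' k) (wc_c D' k) = F k.
  apply: weight_complex_data_exists => k; rewrite /F; case: ifP => [nk|_].
    exists L, b, c; split=> //; exact: wle_le nk An.
  exact: wc_cP.
exists (wc_complex D'); split; last exact: weight_complex_independent.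
move=> i ni; apply: wc_zero; rewrite !FE /F.
by rewrite !ifT //; lia.
Qed.

Lemma Kst_ge_extension (M : C) (D : weight_complex_data w M) n B R :
  wge w n B -> right_degenerate w R -> extension_of M B R -> Kst_ge n (wc_complex D).
Proof.
move=> Bn Rr [a [b [c T]]].
pose F k := if (k < n)%R then existT (fun L => mor L M) R a
            else existT _ (wc_le D k) (wc_c D k).
have [D' FE] : exists D' : weight_complex_data w M,
    forall k, existT (fun L => mor L M) (wc_le D' k) (wc_c D' k) = F k.
  apply: weight_complex_data_exists => k; rewrite /F; case: ifP => [kn|_].
    exists B, b, c; split=> //; apply: wge_le Bn; lia.
  exact: wc_cP.
exists (wc_complex D'); split; last exact: weight_complex_independent.
move=> i ni; apply: wc_zero; rewrite !FE /F.
by rewrite !ifT //; lia.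
Qed.

End Functoriality.

(** * Decompositions avoiding a weight *)

Lemma dist_cocone (C : triangulated) (Y Z : C) (g : mor Y Z) :
  exists X (f : mor X Y) (h : mor Z (sh X)), dist f g h.
Proof.
have [W [a [b D]]] := dist_cone g; have [X [u uI]] := sh_surj W.
have [v [vu uv]] := uI; have [f fE] := sh_full (- (b \oc v)).
exists X, f, (u \oc a); apply/dist_rot; rewrite fE opprK.
apply: dist_iso (iso1 _) (iso1 _) uI _ _ _ D.
- by rewrite comp1m compm1.
- by rewrite compm1.
- by rewrite fmap1 comp1m -compA vu compm1.
Qed.

Section Avoidance.
Variables (C : triangulated) (w : weight_structure C).
Implicit Types (M A R : C) (m k n : int).

Definition avoids_weight m M A R : Prop :=
  [/\ wle w (m - 1) A, wge w (m + 1) R & extension_of M R A].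

(* In degree -m the identity of the weight complex is d x + y d, so that d x is
   idempotent there; let U be its image.  The composite w_{<= m} M -> U[m] is a
   split epimorphism, and its fibre A is the new w_{<= m-1} M. *)
Lemma kills_weight_avoids m M (D : weight_complex_data w M) :
  weight_karoubian w -> kills_weight w m (idm M) ->
  exists A R, avoids_weight m M A R.
Proof.
move=> wK; have -> : m = - (- m - 1 + 1) by lia.
move: (- m - 1) => i {m} Mk.
have [x [y xyE]] := iffRL (null_at_kills D i) Mk.
have [q0 [dq cq _]] := wc_q0_exists D i.
set X := wc_complex D in x y xyE dq *.
set L := wc_le D (- (i + 1)); set p := wc_p D (i + 1); set c := wc_c D (- (i + 1)).
have cD : weight_decomposition w (- (i + 1)) c := wc_cP D _.
have dx : (cdiff X i \oc x) \oc (cdiff X i \oc x) = cdiff X i \oc x.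
  have -> : cdiff X i \oc x = idm _ - y \oc cdiff X (i + 1) by rewrite xyE addrK.
  (* Multiply [d x + y d = 1] on the left by [y d] and use [d d = 0]. *)
  have ydd : y \oc cdiff X (i + 1) \oc (y \oc cdiff X (i + 1)) = y \oc cdiff X (i + 1).
    rewrite -[X in _ \oc X](addKr (cdiff X i \oc x)) -xyE compDr compm1 compmN.
    by rewrite -!compA [cdiff X (i + 1) \oc _]compA cdiffK comp0m compm0 oppr0 add0r.
  by rewrite compBl !compBr !compm1 comp1m ydd subrr subr0.
have [U [io [ro [rio ior]]]] := wK _ _ dx.
pose pi := hshm (i + 1) ro \oc p.
(* Since [p \oc q0] is the differential, [pi \oc si] becomes [ro d x io], which is the identity. *)
pose si := q0 \oc hshm (i + 1) (x \oc io).
have psi : pi \oc si = idm _.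
  rewrite /pi /si -compA [p \oc _]compA -dq -!hshmM [cdiff X i \oc _]compA.
  by rewrite -ior -!compA rio compm1 rio hshm1.
have [A [al [de T]]] := dist_cocone pi.
have de0 : de = 0 by rewrite -[de]compm1 -psi compA (tri_comp2 T) comp0m.
have al_inj B (b : mor B A) : al \oc b = 0 -> b = 0.
  move=> /(tri_desuspend T)[b' b'E]; apply: sh_faithful.
  by rewrite b'E de0 comp0m fmap0.
have [|r0 r0E] := tri_lift1 T (a := idm _ - si \oc pi).
  by rewrite compBr compm1 compA psi comp1m subrr.
have r0al : r0 \oc al = idm A.
  apply: subr0_eq; apply: al_inj.
  by rewrite compBr compA -r0E compBl comp1m -compA (tri_comp1 T) compm0 subr0 compm1 subrr.
have [s cs] := iffLR (kills_weightP (idm M) cD (wc_cP D (- (i + 1 + 1))) ltac:(lia)) Mk.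
(* Killing the weight lets [c] pass through $w_{\le -(i+2)}M$, where [pi] vanishes; so every map
   through [c] from weight at most $-(i+1)$ comes from [A]. *)
have cgs : c \oc (wc_g D (i + 1) \oc s) = c by rewrite compA wc_gP -cs comp1m.
have pg0 : pi \oc (wc_g D (i + 1) \oc s) = 0.
  by rewrite /pi -compA [p \oc _]compA (tri_comp1 (wc_dist D (i + 1))) comp0m compm0.
have [R [r [e TR]]] := dist_cone (c \oc al).
exists A, R; split; last by exists (c \oc al), r, e.
  apply: wleP => B b Bw; rewrite subrK in Bw.
  have [z zE] := wc_ext1 (D := D) (b \oc r0) Bw.
  rewrite -[b]compm1 -r0al compA zE -compA.
  have -> : p \oc al = 0; last by rewrite compm0.
  (* As [y d] dies on [p], all of [p] comes from [pi], so it vanishes on [A]. *)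
  have pE : p = hshm (i + 1) io \oc pi.
    rewrite /pi compA -hshmM ior.
    rewrite -[LHS]comp1m -hshm1 xyE hshmD compDl [hshm _ (y \oc _)]hshmM.
    by rewrite -[hshm _ y \oc _ \oc p]compA (wc_diff_p D (i + 1)) compm0 addr0.
  by rewrite pE -compA (tri_comp1 T) compm0.
apply: wgeP => B b Bw.
have [|b' ->] := tri_lift2 TR (a := b).
  have alI : fmap sh r0 \oc fmap sh al = idm _ by rewrite -fmapM r0al fmap1.
  rewrite -[LHS]comp1m -alI -compA.
  rewrite (_ : fmap sh al \oc (e \oc b) = 0) ?compm0 //.
  apply: (wd_inj (wd_sh cD) _ Bw); first lia.
  by rewrite compm0 !compA -fmapM (tri_comp3 TR) comp0m.
have [d ->] := wd_lift cD b' (lexx _) Bw.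
rewrite -cgs -compA; have [d' ->] : exists d', wc_g D (i + 1) \oc s \oc d = al \oc d'.
  by apply: (tri_lift1 T); rewrite compA pg0 comp0m.
by rewrite !compA -(compA r) (tri_comp1 TR) comp0m.
Qed.

(** The identity of [M] induces maps both ways between the triangles. Maps from $A[1]$ to [R]
    vanish, so the composites on [A] and [R] are identities. *)
Lemma extension_retracts M A R A' R' :
  extension_of M R A -> extension_of M R' A' ->
  (forall f : mor A' R, f = 0) -> (forall f : mor A R', f = 0) ->
  (forall f : mor (sh A) R, f = 0) -> retract_of A A' /\ retract_of R R'.
Proof.
move=> [a [b [c T]]] [a' [b' [c' T']]] A'R AR' AR; split.
  have [s sE] := tri_lift1 T' (AR' (b' \oc a)).
  have [r rE] := tri_lift1 T (A'R (b \oc a')).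
  exists s, r; apply: subr0_eq; apply: sh_faithful; rewrite fmap0.
  have [|d ->] := tri_desuspend T (a := r \oc s - idm A); last by rewrite (AR d) compm0.
  by rewrite compBr compA -rE -sE compm1 subrr.
have [s sE] := tri_ext1 T (AR' (b' \oc a)).
have [r rE] := tri_ext1 T' (A'R (b \oc a')).
exists s, r; apply: subr0_eq.
have [|d ->] := tri_ext2 T (b := r \oc s - idm R); last by rewrite (AR d) comp0m.
by rewrite compBl -compA -sE -rE comp1m subrr.
Qed.

(** The bound on [R] climbs one weight at a time: if [R] has weight at least $k$, it is a retract of
    the right part of a triangle avoiding $k$, hence has weight at least $k+1$. *)
Lemma avoids_left_degenerate m M A R : avoids_weight m M A R ->
  (forall k, (m < k)%R -> exists A' R', avoids_weight k M A' R') ->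
  left_degenerate w R.
Proof.
move=> [Am Rm T] MK.
have Rj (j : nat) : wge w (m + 1 + j%:Z) R.
  elim: j => [|j IHj]; first by rewrite addr0.
  have [|A' [R' [A'k R'k T']]] := MK (m + 1 + j%:Z); first by lia.
  have -> : m + 1 + j.+1%:Z = m + 1 + j%:Z + 1 by lia.
  apply: (wge_retract _ R'k); apply: (extension_retracts T T' _ _ _).2 => f.
  - by apply: w_orthogonal A'k IHj; lia.
  - by apply: w_orthogonal Am R'k; lia.
  - by apply: w_orthogonal (wle_sh Am) Rm; lia.
by move=> i; have := Rj (absz (i - (m + 1))%R); apply: wge_le; lia.
Qed.

Lemma avoids_right_degenerate m M A R : avoids_weight m M A R ->
  (forall k, (k < m)%R -> exists A' R', avoids_weight k M A' R') ->
  right_degenerate w A.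
Proof.
move=> [Am Rm T] MK.
have Aj (j : nat) : wle w (m - 1 - j%:Z) A.
  elim: j => [|j IHj]; first by rewrite subr0.
  have [|A' [R' [A'k R'k T']]] := MK (m - 1 - j%:Z); first by lia.
  have -> : m - 1 - j.+1%:Z = m - 1 - j%:Z - 1 by lia.
  apply: (wle_retract _ A'k); apply: (extension_retracts T T' _ _ _).1 => f.
  - by apply: w_orthogonal A'k Rm; lia.
  - by apply: w_orthogonal IHj R'k; lia.
  - by apply: w_orthogonal (wle_sh Am) Rm; lia.
by move=> i; have := Aj (absz (i - (m - 1))%R); apply: wle_le; lia.
Qed.

(** A homotopy equivalence to a complex with zero term in degree $j$ writes the identity there as
    [d x + y d]. *)
Lemma zero_at_kills M (D : weight_complex_data w M) (Y : complex (Hw w)) j :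
  is_zero (Y j) -> @isomorphic (Khtpy (Hw w)) (wc_complex D) Y ->
  kills_weight w (- j) (idm M).
Proof.
move=> Y0 [f' fI]; have [f fE] := cls_surj f'; rewrite -fE in fI.
have /(@quotient_isoP (Ch (Hw w)))[g [[x gf] _]] := fI.
rewrite -(subrK 1 j) in Y0 *; move: (j - 1) Y0 => i Y0.
apply/(null_at_kills D); exists (- x i), (- x (i + 1)).
rewrite compmN compNm -opprD -gf /=.
by rewrite ((Y0 _).2 (f (i + 1))) compm0 sub0r opprK.
Qed.

Lemma extension_degenerate (t : weight_complex_functor w) L R X :
  left_degenerate w L -> right_degenerate w R -> extension_of X L R -> degenerate t X.
Proof.
move=> Ll Rr [a [b [c T]]]; apply/degenerateP => n A B f g An Bn.
have [|f' ->] := tri_lift1 T (a := f); first by apply: w_orthogonal An (Ll (n + 1)); lia.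
rewrite compm1 compA (w_orthogonal (g \oc a) _ (Rr (n - 1)) Bn) ?comp0m //; lia.
Qed.

End Avoidance.

Theorem theorem2p3p4 (C : triangulated) (w : weight_structure C)
    (t : weight_complex_functor w) (M M' : C) (g : mor M M') (n : int) :
  (* I.1 *)
  (forall Z : C, is_cone g Z -> (is_iso (wcf_map t g) <-> degenerate t Z)) /\
  (* I.2 *)
  (forall L R X : C, left_degenerate w L -> right_degenerate w R ->
     extension_of X L R -> degenerate t X) /\
  (* I.3 *)
  ((exists L A : C,
      [/\ left_degenerate w L, wle w n A & extension_of M L A]) ->
   Kst_le n (t M)) /\
  ((exists B R : C,
      [/\ wge w n B, right_degenerate w R & extension_of M B R]) ->
   Kst_ge n (t M)) /\
  (* II *)
  (weight_karoubian w ->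
     (* II.1 *)
     (degenerate t M <->
      exists L R : C,
        [/\ left_degenerate w L, right_degenerate w R & extension_of M L R]) /\
     (* II.2 *)
     (Kst_le n (t M) <->
      exists L A : C,
        [/\ left_degenerate w L, wle w n A & extension_of M L A]) /\
     (Kst_ge n (t M) <->
      exists B R : C,
        [/\ wge w n B, right_degenerate w R & extension_of M B R])).
Proof.
have le_ext : (exists L A : C, [/\ left_degenerate w L, wle w n A & extension_of M L A]) ->
    Kst_le n (t M).
  by move=> [L [A [Ll An T]]]; apply: Kst_le_extension Ll An T.
have ge_ext : (exists B R : C, [/\ wge w n B, right_degenerate w R & extension_of M B R]) ->
    Kst_ge n (t M).
  by move=> [B [R [Bn Rr T]]]; apply: Kst_ge_extension Bn Rr T.
split.
  move=> Z [h [k T]]; rewrite degenerateP.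
  have [m [mP ->]] := wcf_mapP t g; exact: (weight_complex_iso T mP).
split; first by move=> L R X; apply: extension_degenerate.
do 2![split=> //] => wK.
have avoid k := kills_weight_avoids (m := k) (wcf_data t M) wK.
split; [|split].
- split=> [/degenerateP Mk | [L [R [Ll Rr T]]]]; last exact: extension_degenerate Ll Rr T.
  (* Any weight would serve, as all are killed. *)
  have [A [R AR]] := avoid 0 (Mk 0); exists R, A; split.
  + by apply: avoids_left_degenerate AR _ => k _; apply: avoid.
  + by apply: avoids_right_degenerate AR _ => k _; apply: avoid.
  by case: AR.
- split=> // -[Y [Y0 tY]].
  have Mk k : (n < k)%R -> exists A R, avoids_weight w k M A R.
    move=> nk; apply: avoid; rewrite -[k]opprK.
    by apply: zero_at_kills tY; apply: Y0; lia.
  (* The least weight above $n$ puts [A] in weight at most $n$; the larger ones make [R] left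
     degenerate. *)
  have [|A [R AR]] := Mk (n + 1); first by lia.
  have [An _ T] := AR; exists R, A; split=> //; last by rewrite addrK in An.
  by apply: avoids_left_degenerate AR _ => k nk; apply: Mk; lia.
- split=> // -[Y [Y0 tY]].
  have Mk k : (k < n)%R -> exists A R, avoids_weight w k M A R.
    move=> nk; apply: avoid; rewrite -[k]opprK.
    by apply: zero_at_kills tY; apply: Y0; lia.
  (* Dually, [R] has weight at least $n$, and the weights below $n-1$ make [A] right degenerate. *)
  have [|A [R AR]] := Mk (n - 1); first by lia.
  have [_ Rn T] := AR; exists R, A; split=> //; first by rewrite subrK in Rn.
  by apply: avoids_right_degenerate AR _ => k nk; apply: Mk; lia.
Qed.
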